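(* Let $H\in(\frac12,1)$, $\theta>0$, and let $X_t=e^{\theta t}\int_0^te^{-\theta s}dB^H_s$ be the solution of $dX_t=\theta X_tdt+dB^H_t$, $X_0=0$. Define $$\widetilde\theta^{(2)}_T=\frac{\int_0^Te^{-2\theta s}X_sdX_s}{\int_0^Te^{-2\theta s}X_s^2ds}.$$ Then $\widetilde\theta^{(2)}_T\to\theta$ a.s. as $T\to\infty$.
   Context: $B^H$ is a fractional Brownian motion with Hurst index $H$ (centered Gaussian, $B^H_0=0$, $EB^H_tB^H_s=\frac12(t^{2H}+s^{2H}-|t-s|^{2H})$); integrals w.r.t. $B^H$ and $X$ are pathwise (Riemann–Stieltjes/generalized Lebesgue–Stieltjes) integrals. *)

(* Defs.v *)
From HB Require Import structures.
From mathcomp Require Import all_boot all_order all_algebra.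
From mathcomp Require Import all_classical all_reals all_analysis.
Set Implicit Arguments. Unset Strict Implicit. Unset Printing Implicit Defensive.
Import Order.TTheory GRing.Theory Num.Theory.
Import numFieldNormedType.Exports.
Local Open Scope classical_set_scope.
Local Open Scope ring_scope.

Section Defs.
Context {R : realType}.

Definition is_partition (a b : R) (s : seq R) : Prop :=
  s <> [::] /\ head 0 s = a /\ last 0 s = b /\ sorted <%R s.

Definition is_tags (s xi : seq R) : Prop :=
  size xi = (size s).-1 /\
  forall i, (i.+1 < size s)%N -> nth 0 s i <= nth 0 xi i <= nth 0 s i.+1.

Definition mesh_lt (s : seq R) (d : R) : Prop :=
  forall i, (i.+1 < size s)%N -> nth 0 s i.+1 - nth 0 s i < d.

Definition RS_sum (f g : R -> R) (s xi : seq R) : R :=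
  \sum_(i < (size s).-1) f (nth 0 xi i) * (g (nth 0 s i.+1) - g (nth 0 s i)).

Definition is_RS (f g : R -> R) (a b I : R) : Prop :=
  forall e : R, 0 < e -> exists d : R, 0 < d /\
    forall s xi, is_partition a b s -> is_tags s xi -> mesh_lt s d ->
      `|RS_sum f g s xi - I| < e.

(* the value of \int_a^b f dg (when it exists; it is then unique) *)
Definition RSint (f g : R -> R) (a b : R) : R :=
  xget 0 [set I | is_RS f g a b I].

Definition fbm_cov (H t s : R) : R :=
  (t `^ (2 * H) + s `^ (2 * H) - `|t - s| `^ (2 * H)) / 2.

Context {d : measure_display} {T : measurableType d}.

Definition centered_gaussian (P : probability T R) (Y : T -> R) (v : R) : Prop :=
  measurable_fun setT Y /\
  (if v == 0 then {ae P, forall w, Y w = 0}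
   else forall A : set R, measurable A ->
          P (Y @^-1` A) = normal_prob 0 (Num.sqrt v) A).

Definition is_fBm (P : probability T R) (H : R) (B : T -> R -> R) : Prop :=
  {ae P, forall w, B w 0 = 0} /\
  {ae P, forall w, {within `[0, +oo[, continuous (B w)}} /\
  forall (n : nat) (t c : 'I_n -> R), (forall i, 0 <= t i) ->
    centered_gaussian P (fun w => \sum_(i < n) c i * B w (t i))
      (\sum_(i < n) \sum_(j < n) c i * c j * fbm_cov H (t i) (t j)).

Definition fOU (theta : R) (B : T -> R -> R) (w : T) (t : R) : R :=
  expR (theta * t) * RSint (fun s => expR (- (theta * s))) (B w) 0 t.

Definition theta_tilde2 (theta : R) (B : T -> R -> R) (w : T) (Tm : R) : R :=
  RSint (fun s => expR (- (2 * theta * s)) * fOU theta B w s) (fOU theta B w) 0 Tm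
  / RSint (fun s => expR (- (2 * theta * s)) * fOU theta B w s ^+ 2) id 0 Tm.

End Defs.

(* Main.v *)
(** The proof is pathwise. Put [xi_t = e^{- theta t} X_t]. Since
    [X_s dX_s = d(X_s^2)/2] when squared increments are negligible, and
    [X = e^{theta t} xi],
      [\int_0^T e^{-2 theta s} X_s dX_s = xi_T^2 / 2 + theta \int_0^T xi_s^2 ds],
    so the estimator equals [theta + xi_T^2 / (2 \int_0^T xi_s^2 ds)], and it is
    enough that [xi_T] has a finite nonzero limit.

    Gaussian tails and Borel-Cantelli on the dyadic increments of level [n] in
    [[0, 2^n]] give at once Holder regularity of exponent above 1/2, which makes
    squared increments negligible, and polynomial growth, which makes
    [xi_T = e^{- theta T} B_T + theta \int_0^T e^{- theta s} B_s ds] converge.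
    The limit is almost surely nonzero because the Riemann sums of the last
    integral are Gaussian with variance bounded below: for [H > 1/2] the
    covariance is nonnegative, and it is at least 1/2 on [[1, 2]^2]. *)

Require Import Defs.
From HB Require Import structures.
From mathcomp Require Import all_boot all_order all_algebra.
From mathcomp Require Import all_classical all_reals all_analysis.
From mathcomp Require Import measurable_realfun.
From mathcomp Require Import ring lra zify.
Set Implicit Arguments. Unset Strict Implicit. Unset Printing Implicit Defensive.
Import Order.TTheory GRing.Theory Num.Theory.
Import numFieldNormedType.Exports.
Local Open Scope classical_set_scope.
Local Open Scope ring_scope.

(** * Gaussian tails and small balls *)

(* Since [y^2 >= (y - m)^2 + m^2] on [V], the centred density is dominated
   there by [expR (- m^2 / 2 s^2)] times the density centred at [m]. *)
Lemma normal_prob_shift_le (R : realType) (s m : R) (V : set R) :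
  0 < s -> measurable V -> (forall y, V y -> 0 <= m * (y - m)) ->
  (normal_prob 0 s V <= (expR (- (m ^+ 2 / (s ^+ 2 *+ 2))))%:E)%E.
Proof.
move=> s0 mV mV0.
set c := expR _; have c0 : 0 <= c by exact: expR_ge0.
have sn0 : s != 0 by rewrite gt_eqF.
apply: (@le_trans _ _ (\int[lebesgue_measure]_(y in V) (c%:E * (normal_pdf m s y)%:E))%E).
  apply: ge0_le_integral => //=.
  - by move=> y _; rewrite lee_fin normal_pdf_ge0.
  - by apply/measurable_EFinP/measurable_funTS; exact: measurable_normal_pdf.
  - apply/measurable_EFinP/measurable_funTS/measurable_funM => //.
    exact: measurable_normal_pdf.
  - move=> y Vy; rewrite !normal_pdfE// lee_fin mulrCA.
    rewrite ler_wpM2l ?normal_peak_ge0// /normal_fun /c -expRD ler_expR subr0.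
    set q := s ^+ 2 *+ 2; have q0 : 0 <= q^-1 by rewrite invr_ge0 mulrn_wge0 ?sqr_ge0.
    rewrite -(mulNr (m ^+ 2)) -mulrDl ler_wpM2r//.
    have := mV0 y Vy; rewrite !expr2; nra.
rewrite ge0_integralZl//=; last 2 first.
- by apply/measurable_EFinP/measurable_funTS; exact: measurable_normal_pdf.
- by move=> y _; rewrite lee_fin normal_pdf_ge0.
rewrite -[leRHS]mule1 lee_wpmul2l ?lee_fin//.
exact: (probability_le1 (normal_prob m s : probability _ R) mV).
Qed.

Lemma normal_prob_ball_le (R : realType) (s e : R) :
  s != 0 -> 0 <= e ->
  (normal_prob 0 s [set y | (`|y| < e)%R] <= (normal_peak s * (e *+ 2))%:E)%E.
Proof.
move=> s0 e0.
set V : set R := [set y | _].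
have VE : V = `]-e, e[%classic.
  by apply/seteqP; split=> y /=; rewrite /V/= in_itv/= ltr_norml.
have mV : measurable V by rewrite VE.
apply: (@le_trans _ _ (\int[lebesgue_measure]_(y in V) (normal_peak s)%:E)%E).
  apply: ge0_le_integral => //=.
  - by move=> y _; rewrite lee_fin normal_pdf_ge0.
  - by apply/measurable_EFinP/measurable_funTS; exact: measurable_normal_pdf.
  - by move=> y _; rewrite lee_fin normal_pdf_ub.
rewrite integral_cst//= VE lebesgue_measure_itv/= lte_fin.
case: ifPn => [_|_]; first by rewrite -EFinB opprK -mulr2n -EFinM.
by rewrite mule0 lee_fin mulr_ge0 ?normal_peak_ge0// mulrn_wge0.
Qed.

(** Each of the two half-lines is an instance of the shift bound, centred at [x] and at [- x]. *)
Lemma centered_gaussian_tail (R : realType) (d : measure_display)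
  (T : measurableType d) (P : probability T R) (Y : T -> R) (v x : R) :
  0 < v -> 0 <= x -> centered_gaussian P Y v ->
  (P [set w | (x < `|Y w|)%R] <= (expR (- (x ^+ 2 / (v *+ 2))) *+ 2)%:E)%E.
Proof.
move=> v0 x0 [mY]; rewrite gt_eqF// => PY.
pose A : set R := [set y | x < y]; pose A' : set R := [set y | y < - x].
have mA : measurable A.
  have -> : A = `]x, +oo[%classic by apply/seteqP; split=> y /=; rewrite in_itv/= andbT.
  exact: measurable_itv.
have mA' : measurable A'.
  have -> : A' = `]-oo, - x[%classic by apply/seteqP; split=> y /=; rewrite in_itv/=.
  exact: measurable_itv.
have -> : [set w | x < `|Y w|] = (Y @^-1` A) `|` (Y @^-1` A').
  apply/seteqP; split=> w /=; rewrite /A/A'/=.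
    by rewrite lter_normr orbC => /orP[]; [rewrite ltrNr; right|left].
  by rewrite lter_normr => -[->//|]; rewrite -ltrNr => ->; rewrite orbT.
have mpre (C : set R) : measurable C -> measurable (Y @^-1` C).
  by move=> mC; rewrite -[Y @^-1` C]setTI; exact: mY.
have sv0 : 0 < Num.sqrt v by rewrite sqrtr_gt0.
have svE : Num.sqrt v ^+ 2 = v by rewrite sqr_sqrtr ?ltW.
have hA : (P (Y @^-1` A) <= (expR (- (x ^+ 2 / (v *+ 2))))%:E)%E.
  rewrite PY// -[in leRHS]svE; apply: normal_prob_shift_le => // y /= xy.
  by rewrite mulr_ge0// subr_ge0 ltW.
have hA' : (P (Y @^-1` A') <= (expR (- (x ^+ 2 / (v *+ 2))))%:E)%E.
  rewrite PY// -[in leRHS]svE -(sqrrN x).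
  apply: normal_prob_shift_le => // y /= xy.
  by rewrite mulr_le0 ?oppr_le0// subr_le0 ltW.
apply: (le_trans (measureU2 _ _ _)); [exact: mpre|exact: mpre|].
by rewrite mulr2n EFinD; exact: leeD.
Qed.

(** The peak of the density decreases in the variance, so a lower bound [c] on the variance gives an
    estimate uniform over all Gaussians with variance at least [c]. *)
Lemma centered_gaussian_ball (R : realType) (d : measure_display)
  (T : measurableType d) (P : probability T R) (Y : T -> R) (v c e : R) :
  0 < c -> c <= v -> 0 <= e -> centered_gaussian P Y v ->
  (P [set w | (`|Y w| < e)%R] <= (normal_peak (Num.sqrt c) * (e *+ 2))%:E)%E.
Proof.
move=> c0 cv e0 [mY]; have v0 : 0 < v by exact: lt_le_trans cv.
rewrite gt_eqF// => PY.
have mb : measurable [set y : R | `|y| < e].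
  have -> : [set y : R | `|y| < e] = `]-e, e[%classic; last by [].
  by apply/seteqP; split=> y /=; rewrite in_itv/= ltr_norml.
have -> : [set w | `|Y w| < e] = Y @^-1` [set y | `|y| < e] by [].
rewrite PY//.
apply: le_trans; first by apply: normal_prob_ball_le => //; rewrite gt_eqF// sqrtr_gt0.
rewrite lee_fin ler_wpM2r ?mulrn_wge0// /normal_peak.
rewrite !sqr_sqrtr ?(ltW c0) ?(ltW v0)//.
have h u : 0 < u -> 0 < Num.sqrt (u * pi *+ 2) :> R.
  by move=> u0; rewrite sqrtr_gt0 mulrn_wgt0// mulr_gt0// pi_gt0.
rewrite lef_pV2 ?posrE ?h// ler_wsqrtr// lerMn2r/= ler_wpM2r// pi_ge0//.
Qed.

Definition lim_inf_set {T : Type} (F : (set T)^nat) : set T :=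
  \bigcup_n \bigcap_(j >= n) F j.

Lemma measurable_lim_inf_set {d : measure_display} {T : measurableType d}
  (F : (set T)^nat) :
  (forall n, measurable (F n)) -> measurable (lim_inf_set F).
Proof.
move=> mF; apply: bigcup_measurable => n _.
by apply: bigcap_measurableType => k _; exact: mF.
Qed.

(** The tail intersections increase to the lower limit, and each is contained in its first set, so
    continuity from below passes the bound on. *)
Lemma lim_inf_set_le {R : realType} {d : measure_display} {T : measurableType d}
  (mu : {measure set T -> \bar R}) (F : (set T)^nat) (c : \bar R) (N : nat) :
  (forall n, measurable (F n)) -> (forall n, (N <= n)%N -> (mu (F n) <= c)%E) ->
  (mu (lim_inf_set F) <= c)%E.
Proof.
move=> mF Fc.
have mI n : measurable (\bigcap_(j >= n) F j).
  by apply: bigcap_measurableType => k _; exact: mF.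
have cv : mu (\bigcap_(j >= n) F j) @[n --> \oo] --> mu (lim_inf_set F).
  apply: nondecreasing_cvg_mu => //; first exact: bigcup_measurable.
  move=> m n mn; apply/subsetPset => w h j /= nj.
  by apply: h => /=; exact: leq_trans nj.
rewrite -(cvg_lim _ cv)//; apply: lime_le; first by apply/cvg_ex; eexists; exact: cv.
exists N => // n /= Nn; apply: le_trans (Fc n Nn).
apply: le_measure; rewrite ?inE//; apply: bigcap_inf => /=; exact: leqnn.
Qed.

(** * Errors on the cells of a partition *)

(** Coefficients and errors are all functions of a tagged cell: left end [u], tag [t], right end
    [v]. Values at any of the three points and increments between them then obey one calculus. *)
Definition bounded_on {R : realType} (a b : R) (K : R -> R -> R -> R) : Prop :=
  exists M : R, forall u t v, a <= u -> u <= t -> t <= v -> v <= b ->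
    `|K u t v| <= M.

Definition vanishing_on {R : realType} (a b : R) (K : R -> R -> R -> R) : Prop :=
  forall e : R, 0 < e -> exists2 d : R, 0 < d &
    forall u t v, a <= u -> u <= t -> t <= v -> v <= b -> v - u < d ->
      `|K u t v| <= e.

(* [D u t v] is the error committed on a cell [[u, v]] with tag [t]; it is
   negligible for Riemann-Stieltjes sums when it is [o(v - u)]. *)
Definition negligible_on {R : realType} (a b : R) (D : R -> R -> R -> R) : Prop :=
  forall e : R, 0 < e -> exists2 d : R, 0 < d &
    forall u t v, a <= u -> u <= t -> t <= v -> v <= b -> v - u < d ->
      `|D u t v| <= e * (v - u).

(** This says that [D] is [o(sqrt (v - u))], stated through squares. A product of two such terms is
    negligible, which is how Holder exponents above 1/2 enter. *)
Definition half_negligible_on {R : realType} (a b : R) (D : R -> R -> R -> R) :=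
  negligible_on a b (fun u t v => D u t v ^+ 2).

Section CellErrors.
Context {R : realType} (a b : R).
Implicit Types (D K : R -> R -> R -> R) (f g F : R -> R).

Lemma negligible_ext D D' : (forall u t v, D u t v = D' u t v) ->
  negligible_on a b D -> negligible_on a b D'.
Proof.
by move=> h; have -> : D' = D by apply/funext => u; apply/funext => t; apply/funext => v.
Qed.

Lemma negligible_ext_on D D' :
  (forall u t v, a <= u -> u <= t -> t <= v -> v <= b -> D u t v = D' u t v) ->
  negligible_on a b D -> negligible_on a b D'.
Proof.
move=> h nD e e0; have [d d0 hd] := nD e e0; exists d => // u t v au ut tv vb vu.
by rewrite -h//; exact: hd.
Qed.

Lemma negligible_le D D' :
  (forall u t v, `|D' u t v| <= `|D u t v|) ->
  negligible_on a b D -> negligible_on a b D'.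
Proof.
move=> h nD e e0; have [d d0 hd] := nD e e0; exists d => // u t v au ut tv vb vu.
exact: le_trans (h _ _ _) (hd _ _ _ au ut tv vb vu).
Qed.

Lemma negligibleD D1 D2 : negligible_on a b D1 -> negligible_on a b D2 ->
  negligible_on a b (fun u t v => D1 u t v + D2 u t v).
Proof.
move=> h1 h2 e e0; have e20 : 0 < e / 2 by rewrite divr_gt0.
have [d1 d10 hd1] := h1 _ e20; have [d2 d20 hd2] := h2 _ e20.
exists (Num.min d1 d2); first by rewrite lt_min d10.
move=> u t v au ut tv vb; rewrite lt_min => /andP[vu1 vu2].
apply: le_trans (ler_normD _ _) _; rewrite [e]splitr mulrDl.
by apply: lerD; [exact: hd1|exact: hd2].
Qed.

Lemma negligibleM K D : bounded_on a b K -> negligible_on a b D ->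
  negligible_on a b (fun u t v => K u t v * D u t v).
Proof.
move=> [M hM] h e e0.
have M0 : 0 < `|M| + 1 by rewrite ltr_pwDr.
have eM0 : 0 < e / (`|M| + 1) by rewrite divr_gt0.
have [d d0 hd] := h _ eM0; exists d => // u t v au ut tv vb vu; rewrite normrM.
have -> : e * (v - u) = (`|M| + 1) * (e / (`|M| + 1) * (v - u)).
  by field; rewrite gt_eqF.
rewrite ler_pM//; last exact: hd.
by apply: le_trans (hM _ _ _ au ut tv vb) _; rewrite (le_trans (ler_norm _))// lerDl.
Qed.

Lemma vanishing_negligible K : vanishing_on a b K ->
  negligible_on a b (fun u t v => K u t v * (v - u)).
Proof.
move=> h e e0; have [d d0 hd] := h e e0; exists d => // u t v au ut tv vb vu.
have vu0 : 0 <= v - u by rewrite subr_ge0 (le_trans ut).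
by rewrite normrM (ger0_norm vu0) ler_wpM2r// hd.
Qed.

Lemma vanishingM K K' : bounded_on a b K -> vanishing_on a b K' ->
  vanishing_on a b (fun u t v => K u t v * K' u t v).
Proof.
move=> [M hM] h e e0.
have M0 : 0 < `|M| + 1 by rewrite ltr_pwDr.
have eM0 : 0 < e / (`|M| + 1) by rewrite divr_gt0.
have [d d0 hd] := h _ eM0; exists d => // u t v au ut tv vb vu; rewrite normrM.
have -> : e = (`|M| + 1) * (e / (`|M| + 1)) by field; rewrite gt_eqF.
rewrite ler_pM//; last exact: hd.
by apply: le_trans (hM _ _ _ au ut tv vb) _; rewrite (le_trans (ler_norm _))// lerDl.
Qed.

Lemma bounded_cst (c : R) : bounded_on a b (fun _ _ _ => c).
Proof. by exists `|c|. Qed.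

Lemma boundedM K K' : bounded_on a b K -> bounded_on a b K' ->
  bounded_on a b (fun u t v => K u t v * K' u t v).
Proof.
move=> [M hM] [M' hM']; exists (M * M') => u t v au ut tv vb.
by rewrite normrM ler_pM ?hM ?hM'.
Qed.

Lemma half_negligibleD D1 D2 :
  half_negligible_on a b D1 -> half_negligible_on a b D2 ->
  half_negligible_on a b (fun u t v => D1 u t v + D2 u t v).
Proof.
move=> h1 h2; have h := negligibleM (bounded_cst 2) (negligibleD h1 h2).
apply: negligible_le h => u t v; rewrite (ger0_norm (sqr_ge0 _)).
apply: le_trans (ler_norm _).
have := sqr_ge0 (D1 u t v - D2 u t v); rewrite !expr2; nra.
Qed.

Lemma half_negligibleM K D : bounded_on a b K -> half_negligible_on a b D ->
  half_negligible_on a b (fun u t v => K u t v * D u t v).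
Proof.
move=> bK hD; have := negligibleM (boundedM bK bK) hD.
by apply: negligible_ext => u t v; rewrite exprMn expr2.
Qed.

Lemma half_negligible_mul D1 D2 :
  half_negligible_on a b D1 -> half_negligible_on a b D2 ->
  negligible_on a b (fun u t v => D1 u t v * D2 u t v).
Proof.
move=> h1 h2; apply: negligible_le (negligibleD h1 h2) => u t v.
rewrite (ger0_norm (addr_ge0 (sqr_ge0 _) (sqr_ge0 _))) ler_norml !expr2.
have := sqr_ge0 (D1 u t v - D2 u t v); have := sqr_ge0 (D1 u t v + D2 u t v).
rewrite !expr2 => h h'; apply/andP; split; nra.
Qed.

Lemma half_negligible_left (G : R -> R -> R) :
  half_negligible_on a b (fun u _ v => G u v) ->
  half_negligible_on a b (fun u t _ => G u t).
Proof.
move=> h e e0; have [d d0 hd] := h e e0; exists d => // u t v au ut tv vb vu.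
have tu : t - u <= v - u by rewrite lerD2r.
apply: le_trans (hd u u t au _ ut _ _) _ => //.
- exact: le_trans tv vb.
- exact: le_lt_trans vu.
- by rewrite ler_wpM2l// ltW.
Qed.

Lemma uniform_continuous_on f : (forall x, a <= x <= b -> {for x, continuous f}) ->
  forall e : R, 0 < e -> exists2 d : R, 0 < d &
    forall x y, a <= x <= b -> a <= y <= b -> `|x - y| < d -> `|f x - f y| <= e.
Proof.
move=> cf e e0.
have := @segment_compact R a b; rewrite compact_near_coveringP => nc.
(* Heine-Cantor by the near-covering form of compactness: the parameter [d] runs along the filter of
   small positive radii, and half of a local radius of continuity serves nearby points. *)
have [] := nc R (0 : R)^'+ (fun d x => forall y, `|x - y| < d -> `|f x - f y| <= e).
  move=> x /=; rewrite in_itv/= => xab.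
  have e20 : 0 < e / 2 by rewrite divr_gt0.
  have := cf x xab => /cvgrPdist_lt /(_ _ e20)[r /= r0 hr].
  have r20 : 0 < r / 2 by rewrite divr_gt0.
  exists (ball x (r / 2), [set d : R | d < r / 2]) => /=.
    split; first exact: nbhsx_ballx.
    exact: nbhs_right_lt.
  move=> [x' d] /= [xx' dr] y x'y.
  have -> : f x' - f y = (f x - f y) - (f x - f x') by ring.
  apply: le_trans (ler_normB _ _) _; rewrite [e]splitr lerD// ltW//.
    apply: hr; rewrite /ball/= [r]splitr.
    have -> : x - y = (x - x') + (x' - y) by ring.
    rewrite (le_lt_trans (ler_normD _ _))// ltrD//; exact: lt_trans x'y dr.
  by apply: hr; rewrite /ball/=; apply: lt_trans xx' _; rewrite ltr_pdivrMr// ltr_pMr// ltr1n.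
move=> r /= r0 hr; exists (r / 2); first by rewrite divr_gt0.
move=> x y xab yab; have r20 : 0 < r / 2 by rewrite divr_gt0.
apply: (hr (r / 2)) => //=.
by rewrite sub0r normrN gtr0_norm// ltr_pdivrMr// ltr_pMr// ltr1n.
Qed.

Lemma bounded_continuous_on f : (forall x, a <= x <= b -> {for x, continuous f}) ->
  exists M : R, forall x, a <= x <= b -> `|f x| <= M.
Proof.
move=> cf; have /compact_bounded[M [_ hM]] : compact (f @` `[a, b]%classic).
  apply: continuous_compact; last exact: segment_compact.
  by apply: continuous_in_subspaceT => x /set_mem/=; rewrite in_itv/=; exact: cf.
exists (M + 1) => x xab; apply: hM; first by rewrite ltrDl.
by exists x => //=; rewrite in_itv.
Qed.

Lemma bounded_continuous f : (forall x, a <= x <= b -> {for x, continuous f}) ->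
  [/\ bounded_on a b (fun u _ _ => f u), bounded_on a b (fun _ t _ => f t) &
      bounded_on a b (fun _ _ v => f v)].
Proof.
move=> /bounded_continuous_on[M hM].
by split; exists M => u t v au ut tv vb; apply: hM;
  rewrite ?(le_trans au)// ?(le_trans ut)// ?(le_trans tv)//
     ?(le_trans au (le_trans ut tv))// ?(le_trans ut (le_trans tv vb)).
Qed.

Lemma vanishing_continuous f : (forall x, a <= x <= b -> {for x, continuous f}) ->
  [/\ vanishing_on a b (fun u t _ => f t - f u),
      vanishing_on a b (fun _ t v => f v - f t) &
      vanishing_on a b (fun u _ v => f v - f u)].
Proof.
move=> cf; split=> e e0; have [d d0 hd] := uniform_continuous_on cf e0;
  exists d => // u t v au ut tv vb vu; apply: hd;
  rewrite ?(le_trans au ut) ?(le_trans tv vb) ?(le_trans ut (le_trans tv vb))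
          ?au ?vb ?(le_trans au (le_trans ut tv))//;
  by rewrite ger0_norm ?subr_ge0 ?(le_trans ut tv)//; lra.
Qed.

Lemma derive_continuous_for F f (x : R) : is_derive x 1 F (f x) -> {for x, continuous F}.
Proof.
by move=> dF; apply: differentiable_continuous; apply/derivable1_diffP.
Qed.

(** By the mean value theorem the increment of [F] is [f c * (v - u)] with [c] in the cell, and
    uniform continuity of [f] replaces [c] by the tag. *)
Lemma negligible_derive F f :
  (forall x, a <= x <= b -> is_derive x 1 F (f x)) ->
  (forall x, a <= x <= b -> {for x, continuous f}) ->
  negligible_on a b (fun u t v => F v - F u - f t * (v - u)).
Proof.
move=> dF cf e e0; have [d d0 hd] := uniform_continuous_on cf e0.
exists d => // u t v au ut tv vb vu; have uv := le_trans ut tv.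
have ab x : u <= x -> x <= v -> a <= x <= b.
  by move=> ux xv; rewrite (le_trans au ux) (le_trans xv vb).
have [c] : exists2 c, c \in `[u, v]%R & F v - F u = f c * (v - u).
  apply: MVT_segment => // [x|].
    by rewrite in_itv/= => /andP[/ltW ux /ltW xv]; apply: dF; exact: ab.
  apply: continuous_in_subspaceT => x /set_mem/=; rewrite in_itv/= => /andP[ux xv].
  by apply: derive_continuous_for; apply: dF; exact: ab.
rewrite in_itv/= => /andP[uc cv] ->.
rewrite -mulrBl normrM (ger0_norm (_ : 0 <= v - u)) ?subr_ge0// ler_wpM2r ?subr_ge0//.
apply: hd; [exact: ab|exact: ab|].
by rewrite ltr_norml; apply/andP; split; lra.
Qed.

(** One factor of the squared increment is replaced by [f t * (v - u)] plus a negligible error; the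
    other factor is bounded and tends to 0 with the mesh. *)
Lemma half_negligible_derive F f :
  (forall x, a <= x <= b -> is_derive x 1 F (f x)) ->
  (forall x, a <= x <= b -> {for x, continuous f}) ->
  half_negligible_on a b (fun u _ v => F v - F u).
Proof.
move=> dF cf.
have cF x : a <= x <= b -> {for x, continuous F}.
  by move=> xab; apply: derive_continuous_for; exact: dF.
have [_ _ vF] := vanishing_continuous cF.
have [bFu _ bFv] := bounded_continuous cF; have [_ bf _] := bounded_continuous cf.
have bF : bounded_on a b (fun u _ v => F v - F u).
  have [M hM] := bounded_continuous_on cF; exists (M + M) => u t v au ut tv vb.
  apply: le_trans (ler_normB _ _) _; apply: lerD; apply: hM; rewrite ?au ?vb ?andbT/=.
    by rewrite (le_trans au)// (le_trans ut).
  by rewrite (le_trans ut)// (le_trans tv).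
have h1 := negligibleM bF (negligible_derive dF cf).
have h2 := vanishing_negligible (vanishingM bf vF).
apply: negligible_ext (negligibleD h1 h2) => u t v; ring.
Qed.

End CellErrors.

(** The base point [m] of the integral lies strictly between [a] and [c], so every [x > c] is
    interior to the interval [[m, x + 1]], on which [f] is continuous. *)
Lemma antiderivative_exists {R : realType} (f : R -> R) (a c : R) : a < c ->
  (forall x, a < x -> {for x, continuous f}) ->
  exists F : R -> R, forall x, c < x -> is_derive x 1 F (f x).
Proof.
move=> ac cf; pose m := (a + c) / 2.
have am : a < m by rewrite /m; lra.
have mc : m < c by rewrite /m; lra.
exists (fun x => \int[lebesgue_measure]_(t in `[m, x]) f t)%R => x cx.
have := @continuous_FTC1_closed R f m x (x + 1).
have int : lebesgue_measure.-integrable `[m, x + 1] (EFin \o f).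
  apply: continuous_compact_integrable; first exact: segment_compact.
  apply: continuous_in_subspaceT => y /set_mem/=; rewrite in_itv/= => /andP[my _].
  by apply: cf; exact: lt_le_trans my.
case=> //; rewrite ?ltrDl//; first exact: lt_trans cx.
  by apply: cf; lra.
by move=> dF dE; apply: DeriveDef => //; rewrite -derive1E.
Qed.

(** * Riemann-Stieltjes sums *)

Section RiemannStieltjes.
Context {R : realType}.
Implicit Types (f g F : R -> R) (a b I J : R).

(** The increments of [F] telescope, so the sum misses [F b - F a] by the total of the cell errors,
    a small multiple of [b - a]. Guessing [F] thus proves existence and value of the integral at
    once. The [+ 1] in the constant covers [a = b]. *)
Lemma is_RS_negligible f g F a b : a <= b ->
  negligible_on a b (fun u t v => f t * (g v - g u) - (F v - F u)) ->
  is_RS f g a b (F b - F a).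
Proof.
move=> ab h e e0; have c0 : 0 < b - a + 1 by rewrite ltr_wpDl// subr_ge0.
have ec0 : 0 < e / (b - a + 1) by rewrite divr_gt0.
have [d d0 hd] := h _ ec0; exists d; split=> // s xi [s0 [ha [hb ss]]] [sxi txi] ms.
set n := (size s).-1.
have sz : size s = n.+1 by rewrite /n; case: s s0 {ha hb ss sxi txi ms n}.
have h0 : nth 0 s 0 = a by rewrite nth0.
have hn : nth 0 s n = b by rewrite /n nth_last.
have mono i j : (i <= j)%N -> (j < n.+1)%N -> nth 0 s i <= nth 0 s j.
  rewrite leq_eqVlt => /orP[/eqP ->//|ij] jn; apply/ltW.
  by apply: (sorted_ltn_nth lt_trans) => //; rewrite inE sz// (ltn_trans ij).
have tel G : G b - G a = \sum_(i < n) (G (nth 0 s i.+1) - G (nth 0 s i)) :> R.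
  rewrite -(big_mkord xpredT (fun i => G (nth 0 s i.+1) - G (nth 0 s i))).
  by rewrite telescope_sumr// hn h0.
rewrite /RS_sum -/n (tel F) -sumrB.
apply: (@le_lt_trans _ _ (\sum_(i < n) e / (b - a + 1) * (nth 0 s i.+1 - nth 0 s i))).
  apply: le_trans (ler_norm_sum _ _ _) _; apply: ler_sum => i _.
  have i1 : (i.+1 < size s)%N by rewrite sz ltnS.
  have /andP[t1 t2] := txi i i1.
  apply: hd => //; last exact: ms.
    by rewrite -h0; apply: mono => //; rewrite ltnW// ltnS.
  by rewrite -hn; apply: mono.
rewrite -mulr_sumr -(tel id)/= mulrAC ltr_pdivrMr//.
by rewrite ltr_pM2l// ltrDl.
Qed.

Definition uniform_points a h (N : nat) : seq R := mkseq (fun i => a + i%:R * h) N.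

Lemma nth_uniform_points a h N i : (i < N)%N ->
  nth 0 (uniform_points a h N) i = a + i%:R * h.
Proof. by move=> iN; rewrite nth_mkseq. Qed.

Lemma uniform_partition a b h N : 0 < h -> a + N%:R * h = b ->
  is_partition a b (uniform_points a h N.+1).
Proof.
move=> h0 <-; split=> //; split; first by rewrite /= mul0r addr0.
split; first by rewrite -nth_last size_mkseq/= nth_uniform_points.
apply/(sortedP 0) => i; rewrite size_mkseq => iN.
by rewrite !nth_uniform_points//; [rewrite ltrD2l ltr_pM2r// ltr_nat|exact: ltnW].
Qed.

Lemma uniform_tags a h N : 0 <= h ->
  is_tags (uniform_points a h N.+1) (uniform_points a h N).
Proof.
move=> h0; split; first by rewrite !size_mkseq.
move=> i; rewrite size_mkseq => iN.
rewrite !nth_uniform_points// ?(ltnW iN)// lexx/= lerD2l ler_wpM2r// ler_nat//.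
Qed.

Lemma uniform_mesh a h N d : h < d -> mesh_lt (uniform_points a h N.+1) d.
Proof.
move=> hd i; rewrite size_mkseq => iN.
rewrite !nth_uniform_points// ?(ltnW iN)//.
by rewrite -natr1; suff -> : a + (i%:R + 1) * h - (a + i%:R * h) = h by []; ring.
Qed.

Lemma uniform_RS_sum f g a h N :
  RS_sum f g (uniform_points a h N.+1) (uniform_points a h N) =
  \sum_(i < N) f (a + i%:R * h) * (g (a + i.+1%:R * h) - g (a + i%:R * h)).
Proof.
rewrite /RS_sum size_mkseq; apply: eq_bigr => i _.
have iN := ltn_ord i.
by rewrite !nth_uniform_points//; exact: (leq_trans iN).
Qed.

Lemma is_RS_unique f g a b I J : a <= b ->
  is_RS f g a b I -> is_RS f g a b J -> I = J.
Proof.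
move=> ab hI hJ; apply/eqP; rewrite -subr_eq0 -normr_le0; apply/ler_addgt0Pr => e e0.
rewrite add0r; have e20 : 0 < e / 2 by rewrite divr_gt0.
have [d [d0 hd]] := hI _ e20; have [d' [d'0 hd']] := hJ _ e20.
have m0 : 0 < Num.min d d' by rewrite lt_min d0.
have [N [h [h0 hm hN]]] : exists N h, [/\ 0 < h, h < Num.min d d' & a + N%:R * h = b].
  have [ab'|ab'] := eqVneq a b.
    (* For [a = b] the partition is a single point and has no cell. *)
    exists 0%N, (Num.min d d' / 2); rewrite divr_gt0// mul0r addr0 ab'; split=> //.
    by rewrite ltr_pdivrMr// ltr_pMr// ltr1n.
  have ba0 : 0 < b - a by rewrite subr_gt0 lt_neqAle ab'.
  pose N := Num.bound ((b - a) / Num.min d d').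
  have hN : (b - a) / Num.min d d' < N%:R.
    by apply: archi_boundP; rewrite divr_ge0// ltW.
  have N0 : 0 < N%:R :> R by apply: le_lt_trans hN; rewrite divr_ge0// ltW.
  exists N, ((b - a) / N%:R); rewrite divr_gt0//; split=> //.
    by rewrite ltr_pdivrMr// mulrC -ltr_pdivrMr.
  by field; rewrite gt_eqF.
move: hm; rewrite lt_min => /andP[hm hm'].
have P := uniform_partition h0 hN; have Tg := @uniform_tags a h N (ltW h0).
have h1 := hd _ _ P Tg (uniform_mesh hm).
have h2 := hd' _ _ P Tg (uniform_mesh hm').
set S := RS_sum _ _ _ _ in h1 h2.
have -> : I - J = (S - J) - (S - I) by ring.
by apply: le_trans (ler_normB _ _) _; rewrite [e]splitr lerD// ltW.
Qed.

Lemma RSintE f g a b I : a <= b -> is_RS f g a b I -> RSint f g a b = I.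
Proof.
move=> ab hI; apply: xget_unique => // J hJ; exact: is_RS_unique hI.
Qed.

(** With an integer endpoint and step [1 / (K + 1)] the sums form a countable family of finite
    combinations of sampled values; along a Brownian path these are Gaussian variables. *)
Lemma is_RS_riemann_sums f (n : nat) I : is_RS f id 0 n%:R I ->
  forall e, 0 < e -> exists K0 : nat, forall K, (K0 <= K)%N ->
    `|\sum_(i < n * K.+1) K.+1%:R^-1 * f (i%:R * K.+1%:R^-1) - I| < e.
Proof.
move=> hI e e0; have [d [d0 hd]] := hI e e0.
exists (Num.bound d^-1) => K hK.
have K0 : 0 < K.+1%:R :> R by rewrite ltr0n.
have Kd : K.+1%:R^-1 < d.
  rewrite -[d]invrK ltf_pV2 ?posrE ?invr_gt0//.
  apply: lt_le_trans (archi_boundP _) _; first by rewrite invr_ge0 ltW.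
  by rewrite ler_nat (leq_trans hK).
have h0 : 0 < K.+1%:R^-1 :> R by rewrite invr_gt0.
have hN : 0 + (n * K.+1)%:R * K.+1%:R^-1 = n%:R :> R.
  by rewrite natrM; field; rewrite gt_eqF.
have := hd _ _ (uniform_partition h0 hN) (uniform_tags _ _ (ltW h0)) (uniform_mesh Kd).
rewrite uniform_RS_sum => h; apply: le_lt_trans h; rewrite le_eqVlt; apply/orP; left.
apply/eqP; congr (`|_ - _|); apply: eq_bigr => i _.
by rewrite !add0r -natr1; ring.
Qed.

End RiemannStieltjes.

(** * The integrals along a path *)

Lemma is_derive_expRM {R : realType} (c x : R) :
  is_derive x 1 (fun t => expR (c * t)) (c * expR (c * x)).
Proof.
have h : is_derive x 1 (fun t : R => c * t) c.
  by apply: is_derive_eq; rewrite /GRing.scale/= mulr1.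
by have := @is_derive1_comp R expR (fun t => c * t) x _ _ (is_derive_expR _) h; rewrite mulrC.
Qed.

Lemma continuous_expRM {R : realType} (c x : R) : {for x, continuous (fun t => expR (c * t))}.
Proof.
by apply: (derive_continuous_for (f := fun x => c * expR (c * x))); exact: is_derive_expRM.
Qed.

Section Pathwise.
Context {R : realType} (theta : R) (b Z A : R -> R).
Hypothesis b_continuous : forall x : R, {for x, continuous (fun t => b `|t|)}.
Hypothesis b_half_negligible :
  forall T : R, half_negligible_on 0 T (fun u _ v => b v - b u).
Hypothesis b0 : b 0 = 0.
Hypothesis Z0 : Z 0 = 0.
Hypothesis dZ : forall x : R, 0 <= x ->
  is_derive x 1 Z (expR (- theta * x) * b `|x|).

(** This is the integral of [e^{- theta s}] against the path, after integration by parts, with [Z]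
    an ordinary primitive. Reading the path at [|t|] gives two-sided continuity and derivatives at
    0. *)
Let xi (t : R) : R := expR (- theta * t) * b `|t| + theta * Z t.

Hypothesis A0 : A 0 = 0.
Hypothesis dA : forall x : R, 0 <= x -> is_derive x 1 A (xi x ^+ 2).

Let ex_cont (c x : R) := @continuous_expRM R c x.

Let Z_cont (x : R) : 0 <= x -> {for x, continuous Z}.
Proof.
by move=> x0; apply: (derive_continuous_for (f := fun x => expR (- theta * x) * b `|x|)); exact: dZ.
Qed.

Let xi_cont (x : R) : 0 <= x -> {for x, continuous xi}.
Proof.
move=> x0; apply: cvgD; first by apply: cvgM; [exact: ex_cont|exact: b_continuous].
by apply: cvgM; [exact: cvg_cst|exact: Z_cont].
Qed.

Let dex_cont (c x : R) : {for x, continuous (fun x => c * expR (c * x))}.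
Proof. by apply: cvgM; [exact: cvg_cst|exact: ex_cont]. Qed.

Let dZ_cont (x : R) : {for x, continuous (fun x => expR (- theta * x) * b `|x|)}.
Proof. by apply: cvgM; [exact: ex_cont|exact: b_continuous]. Qed.

Let dA_cont (x : R) : 0 <= x -> {for x, continuous (fun x => xi x ^+ 2)}.
Proof. by move=> x0; apply: cvgM; exact: xi_cont. Qed.

Lemma is_RS_exp_path (T : R) : 0 <= T ->
  is_RS (fun s => expR (- (theta * s))) b 0 T (xi T).
Proof.
move=> T0.
have -> : xi T = xi T - xi 0 by rewrite {3}/xi normr0 b0 Z0 !mulr0 addr0 subr0.
apply: is_RS_negligible => //.
have pos (x : R) : 0 <= x <= T -> 0 <= x by case/andP.
have hE := @half_negligible_derive R 0 T (fun t => expR (- theta * t))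
  (fun x => - theta * expR (- theta * x)) (fun x _ => is_derive_expRM _ x)
  (fun x _ => @dex_cont _ x).
have nE := @negligible_derive R 0 T (fun t => expR (- theta * t))
  (fun x => - theta * expR (- theta * x)) (fun x _ => is_derive_expRM _ x)
  (fun x _ => @dex_cont _ x).
have nZ := @negligible_derive R 0 T Z _ (fun x h => dZ (pos x h))
  (fun x _ => @dZ_cont x).
have [bbu _ _] := @bounded_continuous R 0 T _ (fun x _ => @b_continuous x).
have [vb _ _] := @vanishing_continuous R 0 T _ (fun x _ => @b_continuous x).
have [_ bE _] := @bounded_continuous R 0 T _ (fun x _ => @ex_cont (- theta) x).
(* With [E] the exponential, this is [E t - E v], obtained from two increments that start at [u]. *)
have hE' := half_negligibleM (bounded_cst _ _ (-1)) (half_negligibleD hE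
  (half_negligibleM (bounded_cst _ _ (-1)) (half_negligible_left hE))).
(* The cell error is [(E t - E v) (b v - b u)] minus three terms: the linearisation error of [E]
   times [b u], that of [Z] times [theta], and [theta E t (b t - b u) (v - u)]. *)
have n1 := half_negligible_mul hE' (b_half_negligible T).
have n2 := negligibleM bbu nE.
have n3 := negligibleM (bounded_cst 0 T theta) nZ.
have n4 := vanishing_negligible (vanishingM (boundedM (bounded_cst 0 T theta) bE) vb).
have n := negligibleM (bounded_cst 0 T (-1)) (negligibleD n2 (negligibleD n3 n4)).
apply: negligible_ext_on (negligibleD n1 n) => u t v u0 ut tv vT.
have t0 := le_trans u0 ut; have v0 := le_trans t0 tv.
by rewrite /xi -!mulNr !ger0_norm//; ring.
Qed.

(** By the product rule the increment is [E v] times that of [b], plus [b u] times that of the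
    exponential [E], plus [theta] times that of [Z]. *)
Lemma half_negligible_xi (T : R) : half_negligible_on 0 T (fun u _ v => xi v - xi u).
Proof.
have pos (x : R) : 0 <= x <= T -> 0 <= x by case/andP.
have hE := @half_negligible_derive R 0 T (fun t => expR (- theta * t))
  (fun x => - theta * expR (- theta * x)) (fun x _ => is_derive_expRM _ x)
  (fun x _ => @dex_cont _ x).
have hZ := @half_negligible_derive R 0 T Z _ (fun x h => dZ (pos x h))
  (fun x _ => @dZ_cont x).
have [bbu _ _] := @bounded_continuous R 0 T _ (fun x _ => @b_continuous x).
have [_ _ bE] := @bounded_continuous R 0 T _ (fun x _ => @ex_cont (- theta) x).
have h1 := half_negligibleM bE (b_half_negligible T).
have h2 := half_negligibleM bbu hE.
have h3 := half_negligibleM (bounded_cst 0 T theta) hZ.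
apply: negligible_ext_on (half_negligibleD h1 (half_negligibleD h2 h3)) => u t v u0 ut tv vT.
have t0 := le_trans u0 ut; have v0 := le_trans t0 tv.
by rewrite /xi !ger0_norm//; ring.
Qed.

(** The exponentials cancel, leaving the integral of [xi ^+ 2], whose primitive is [A]. *)
Lemma is_RS_weighted_square (Y : R -> R) (T : R) : 0 <= T ->
  (forall s, 0 <= s -> Y s = expR (theta * s) * xi s) ->
  is_RS (fun s => expR (- (2 * theta * s)) * Y s ^+ 2) id 0 T (A T).
Proof.
move=> T0 hY; rewrite -[A T]subr0 -[in X in _ - X]A0; apply: is_RS_negligible => //.
have pos (x : R) : 0 <= x <= T -> 0 <= x by case/andP.
have nA := @negligible_derive R 0 T A _ (fun x h => dA (pos x h))
  (fun x h => dA_cont (pos x h)).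
apply: negligible_ext_on (negligibleM (bounded_cst 0 T (-1)) nA) => u t v u0 ut tv vT.
have t0 := le_trans u0 ut.
rewrite hY// exprMn mulrA -expRM_natr -expRD.
have -> : - (2 * theta * t) + theta * t * 2 = 0 by ring.
by rewrite expR0; ring.
Qed.

(** Formally [e^{- 2 theta s} Y dY = xi dxi + theta xi^2 ds], and [xi dxi = d(xi^2) / 2] because
    squared increments of [xi] are negligible. *)
Lemma is_RS_weighted_self (Y : R -> R) (T : R) : 0 <= T ->
  (forall s, 0 <= s -> Y s = expR (theta * s) * xi s) ->
  is_RS (fun s => expR (- (2 * theta * s)) * Y s) Y 0 T
    (xi T ^+ 2 / 2 + theta * A T).
Proof.
move=> T0 hY; pose F t := xi t ^+ 2 / 2 + theta * A t.
have -> : xi T ^+ 2 / 2 + theta * A T = F T - F 0.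
  by rewrite /F A0 {3}/xi normr0 b0 Z0 !mulr0 !addr0 expr0n/= mul0r subr0.
apply: is_RS_negligible => //.
have pos (x : R) : 0 <= x <= T -> 0 <= x by case/andP.
have hE := @half_negligible_derive R 0 T (fun t => expR (theta * t))
  (fun x => theta * expR (theta * x)) (fun x _ => is_derive_expRM _ x)
  (fun x _ => @dex_cont _ x).
have nE := @negligible_derive R 0 T (fun t => expR (theta * t))
  (fun x => theta * expR (theta * x)) (fun x _ => is_derive_expRM _ x)
  (fun x _ => @dex_cont _ x).
have nA := @negligible_derive R 0 T A _ (fun x h => dA (pos x h))
  (fun x h => dA_cont (pos x h)).
have hx := half_negligible_xi T.
have [_ bEt _] := @bounded_continuous R 0 T _ (fun x _ => @ex_cont (- theta) x).
have [_ bxt bxv] := @bounded_continuous R 0 T _ (fun x h => xi_cont (pos x h)).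
have [_ vx _] := @vanishing_continuous R 0 T _ (fun x h => xi_cont (pos x h)).
(* [n1] and [n2] compare [xi t (xi v - xi u)] with half the increment of [xi ^+ 2]; [n3] and [n4]
   expand the increment of [Y] by the product rule; [n5] and [n6] match the drift with the increment
   of [theta * A]. *)
have n1 := half_negligible_mul (half_negligible_left hx) hx.
have n2 := negligibleM (bounded_cst 0 T (- 2^-1)) (half_negligible_mul hx hx).
have n3 := negligibleM (boundedM (bounded_cst 0 T (-1)) (boundedM bEt bxt))
  (half_negligible_mul (half_negligible_left hE) hx).
have n4 := negligibleM (boundedM bEt (boundedM bxt bxv)) nE.
have n5 := vanishing_negligible (vanishingM (boundedM (bounded_cst 0 T theta) bxt) vx).
have n6 := negligibleM (bounded_cst 0 T (- theta)) nA.
apply: negligible_ext_on (negligibleD n1 (negligibleD n2 (negligibleD n3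
  (negligibleD n4 (negligibleD n5 n6))))) => u t v u0 ut tv vT.
have t0 := le_trans u0 ut; have v0 := le_trans t0 tv.
rewrite !hY//.
have e1 : expR (- theta * t) * expR (theta * t) = 1 by rewrite -expRD mulNr addNr expR0.
have e2 : expR (- (2 * theta * t)) = expR (- theta * t) ^+ 2.
  by rewrite -expRM_natr; congr expR; ring.
have -> : expR (- (2 * theta * t)) * (expR (theta * t) * xi t) = expR (- theta * t) * xi t.
  by rewrite e2 -[RHS]mul1r -e1; ring.
(* The two sides agree only modulo [e^{- theta t} e^{theta t} = 1], so their difference is written
   as an explicit multiple of [1 - e^{- theta t} e^{theta t}]. *)
rewrite /F; apply: subr0_eq.
transitivity ((1 - expR (- theta * t) * expR (theta * t)) *
  (xi t * (xi v - xi u) + theta * xi t * xi v * (v - u))); first by field.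
by rewrite e1 subrr mul0r.
Qed.

End Pathwise.

(** * Limits as time tends to infinity *)

Lemma cvg_expR_decay {R : realType} (c : R) : 0 < c ->
  expR (- c * t) @[t --> +oo] --> 0.
Proof.
move=> c0; under eq_fun do rewrite mulNr.
apply: (cvg_comp (fun t => c * t) (fun x => expR (- x))); last exact: cvgr_expR.
by apply: gt0_cvgMry => //; exact: cvg_id.
Qed.

Lemma cvg_pinfty_near_eq {R : realType} (f g : R -> R) (l : R) :
  (\forall t \near +oo, f t = g t) ->
  f t @[t --> +oo] --> l -> g t @[t --> +oo] --> l.
Proof. by move=> fg; apply: cvg_trans; apply: near_eq_cvg. Qed.

(** Subtracting [k], whose derivative is [- M e^{- c t}], makes both [F] and [- F] nondecreasing on
    the half-line. So [F - k] is monotone and bounded above, while [k] tends to 0. *)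
Lemma cvg_antiderivative_decay {R : realType} (F f : R -> R) (M c : R) : 0 < c ->
  (forall x : R, 0 <= x -> is_derive x 1 F (f x)) ->
  (forall x, 0 <= x -> `|f x| <= M * expR (- c * x)) ->
  exists l : R, F t @[t --> +oo] --> l.
Proof.
move=> c0 dF hf; pose k t : R := M / c * expR (- c * t).
have dk (x : R) : is_derive x 1 k (- M * expR (- c * x)).
  have h := is_derive_expRM (- c) x.
  by apply: is_derive_eq; rewrite /GRing.scale/=; field; rewrite gt_eqF.
have mono (s : R) : `|s| <= 1 -> forall x y, 0 <= x -> x <= y ->
    s * F x - k x <= s * F y - k y.
  move=> s1 x y x0 xy; pose G t : R := s * F t - k t.
  have dG (z : R) : 0 <= z -> is_derive z 1 G (s * f z + M * expR (- c * z)).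
    move=> z0; have h1 := dF z z0; have h2 := dk z.
    by apply: is_derive_eq; rewrite /GRing.scale/=; ring.
  have [z] : exists2 z, z \in `[x, y]%R &
      G y - G x = (s * f z + M * expR (- c * z)) * (y - x).
    apply: MVT_segment => // [z|].
      by rewrite in_itv/= => /andP[/ltW xz _]; apply: dG; exact: le_trans xz.
    apply: continuous_in_subspaceT => z /set_mem/=; rewrite in_itv/= => /andP[xz zy].
    apply: (derive_continuous_for (f := fun z => s * f z + M * expR (- c * z))).
    by apply: dG; exact: le_trans xz.
  rewrite in_itv/= => /andP[xz _] GE; rewrite -subr_ge0 -/(G x) -/(G y) GE.
  rewrite mulr_ge0 ?subr_ge0//; have := hf z (le_trans x0 xz).
  have : `|s * f z| <= `|f z| by rewrite normrM ler_piMl.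
  by have := ler_norm (- (s * f z)); rewrite normrN; lra.
have m1 := mono 1; have m2 := mono (-1); rewrite normrN normr1 lexx in m1 m2.
(* Truncation at 0 extends the monotone function to the whole line. *)
pose h t : R := F (Num.max t 0) - k (Num.max t 0).
have ndh : nondecreasing_fun h.
  move=> x y xy; have := m1 isT (Num.max x 0) (Num.max y 0).
  rewrite !mul1r; apply; first by rewrite le_max lexx orbT.
  by rewrite ge_max !le_max xy lexx orbT.
have ubh : has_ubound (range h).
  exists (F 0 + k 0) => _ [t _ <-]; rewrite /h; set u := Num.max t 0.
  have u0 : 0 <= u by rewrite le_max lexx orbT.
  have := m2 isT 0 u (lexx _) u0; have := m1 isT 0 u (lexx _) u0.
  have M0 : 0 <= M.
    by have := le_trans (normr_ge0 _) (hf 0 (lexx _)); rewrite pmulr_lge0// expR_gt0.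
  have : 0 <= k u by rewrite /k mulr_ge0 ?expR_ge0// divr_ge0// ltW.
  lra.
have ch := nondecreasing_cvgr ndh ubh.
exists (sup (range h)).
have ck : k t @[t --> +oo] --> 0.
  by rewrite -[0](mulr0 (M / c)); apply: cvgM; [exact: cvg_cst|exact: cvg_expR_decay].
have hk : h t + k t @[t --> +oo] --> sup (range h).
  by rewrite -[sup _]addr0; exact: cvgD.
apply: cvg_pinfty_near_eq hk.
near=> t; have t0 : 0 <= t by near: t; apply: nbhs_pinfty_ge; exact: num_real.
by rewrite /= /h (max_idPl t0) subrK.
Unshelve. all: by end_near. Qed.

(** Half of the exponential absorbs the quadratic factor, through [e^y >= 1 + y^2 / 2] at
    [y = c t / 2]; this is where the 8 comes from. *)
Lemma expR_decay_poly2 {R : realType} (c t : R) : 0 < c -> 0 <= t ->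
  expR (- c * t) * (1 + t ^+ 2) <= (1 + 8 / c ^+ 2) * expR (- (c / 2) * t).
Proof.
move=> c0 t0; have -> : - c * t = - (c / 2) * t + - (c / 2) * t by field.
rewrite expRD; set k := expR _.
have kp : k * expR (c / 2 * t) = 1 by rewrite -expRD mulNr addNr expR0.
have k0 : 0 < k by exact: expR_gt0.
rewrite [leRHS]mulrC -mulrA ler_pM2l//.
have ct0 : 0 <= c / 2 * t by rewrite mulr_ge0// divr_ge0// ltW.
have := @expR_ge1Dxn R (c / 2 * t) 1 ct0; rewrite (_ : 2`!%:R = 2)// => h.
have : 1 + t ^+ 2 <= (1 + 8 / c ^+ 2) * expR (c / 2 * t).
  apply: (@le_trans _ _ ((1 + 8 / c ^+ 2) * (1 + (c / 2 * t) ^+ 2 / 2))).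
    have -> : (1 + 8 / c ^+ 2) * (1 + (c / 2 * t) ^+ 2 / 2) =
       (1 + t ^+ 2) + (8 / c ^+ 2 + c ^+ 2 * t ^+ 2 / 8) by field; rewrite gt_eqF.
    have c2 : 0 <= c ^+ 2 by exact: sqr_ge0.
    have t2 : 0 <= t ^+ 2 by exact: sqr_ge0.
    by rewrite lerDl addr_ge0// ?divr_ge0// mulr_ge0.
  have c2 : 0 <= 8 / c ^+ 2 by rewrite divr_ge0// sqr_ge0.
  by rewrite ler_wpM2l// addr_ge0.
move/(ler_wpM2l (ltW k0)) => /le_trans; apply.
by rewrite mulrCA kp mulr1.
Qed.

(* The integral of the square of a function with a nonzero limit diverges, so
   the boundary term of the estimator is washed out. *)
Lemma ratio_cvg {R : realType} (theta l : R) (xi A : R -> R) :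
  xi t @[t --> +oo] --> l -> l != 0 ->
  (forall x : R, 0 <= x -> is_derive x 1 A (xi x ^+ 2)) ->
  (xi t ^+ 2 / 2 + theta * A t) / A t @[t --> +oo] --> theta.
Proof.
move=> cxi l0 dA; pose c := l ^+ 2 / 2.
have c0 : 0 < c by rewrite divr_gt0// exprn_even_gt0.
have cxi2 : xi t ^+ 2 @[t --> +oo] --> l ^+ 2 by apply: cvgM.
have [t0 [_ ht0]] : \forall t \near +oo, c < xi t ^+ 2.
  have l20 : 0 < l ^+ 2 by rewrite exprn_even_gt0.
  by apply: (cvgr_gt _ cxi2); rewrite /c ltr_pdivrMr// ltr_pMr// ltr1n.
pose t1 := Num.max t0 0 + 1.
have t10 : 0 <= t1 by rewrite addr_ge0// le_max lexx orbT.
have t1t0 x : t1 <= x -> t0 < x.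
  by apply: lt_le_trans; rewrite /t1 ltr_pwDr// le_max lexx.
have cA : A t @[t --> +oo] --> +oo.
  (* From [t1] on [xi ^+ 2] exceeds [c], so by the mean value theorem [A] stays above a line of
     slope [c]. *)
  apply: (@ger_cvgy _ _ _ _ (fun t => A t1 + c * (t - t1))).
    near=> t; have t1t : t1 <= t by near: t; apply: nbhs_pinfty_ge; exact: num_real.
    have [z] : exists2 z, z \in `[t1, t]%R & A t - A t1 = xi z ^+ 2 * (t - t1).
      apply: MVT_segment => // [z|].
        by rewrite in_itv/= => /andP[/ltW xz _]; apply: dA; exact: le_trans xz.
      apply: continuous_in_subspaceT => z /set_mem/=; rewrite in_itv/= => /andP[xz zy].
      apply: (derive_continuous_for (f := fun z => xi z ^+ 2)).
      by apply: dA; exact: le_trans xz.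
    rewrite in_itv/= => /andP[tz _] AE; rewrite -lerBrDl AE.
    by rewrite ler_wpM2r ?subr_ge0// ltW//; apply: ht0; exact: t1t0.
  under eq_fun do rewrite mulrBr addrA addrAC.
  apply: (cvg_comp (fun t => c * t) (fun x => A t1 - c * t1 + x)) => /=; last first.
    exact: cvg_addrl.
  by apply: gt0_cvgMry => //; exact: cvg_id.
have A0 : \forall t \near +oo, 0 < A t by move/cvgryPgt : cA; apply.
have cV : (A t)^-1 @[t --> +oo] --> 0 by apply: (gtr0_cvgV0 A0).2.
have c1 : xi t ^+ 2 * 2^-1 @[t --> +oo] --> l ^+ 2 * 2^-1.
  exact: (cvgM cxi2 (cvg_cst _)).
have h : theta + (xi t ^+ 2 * 2^-1) * (A t)^-1 @[t --> +oo] --> theta.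
  rewrite -[X in _ --> X]addr0 -(mulr0 (l ^+ 2 * 2^-1)).
  apply: cvgD; first exact: cvg_cst.
  exact: (cvgM c1 cV).
apply: cvg_pinfty_near_eq h.
near=> t; have At : 0 < A t by near: t.
by rewrite /= mulrDl mulfK ?gt_eqF// addrC.
Unshelve. all: by end_near. Qed.

(** * Convergence of the estimator along one path *)

Lemma continuous_comp_normr {R : realType} (f : R -> R) :
  {within `[0, +oo[, continuous f} -> forall x : R, {for x, continuous (fun t => f `|t|)}.
Proof.
move=> /subspace_continuousP cf x.
have x0 : `[0, +oo[%classic `|x| by rewrite /= in_itv/= normr_ge0.
apply: (cvg_comp (fun t : R => `|t|) f _ (cf _ x0)).
move=> P; rewrite /within/= => nP.
have h : nbhs x (fun t => `[0, +oo[%classic `|t| -> P `|t|) := @norm_continuous R R x _ nP.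
change (nbhs x (fun t => P `|t|)); apply: filterS h => t; apply.
by rewrite /= in_itv/= andbT normr_ge0.
Qed.

Lemma antiderivative_exists0 {R : realType} (f : R -> R) (a c : R) : a < c -> c < 0 ->
  (forall x, a < x -> {for x, continuous f}) ->
  exists F : R -> R, F 0 = 0 /\ forall x, c < x -> is_derive x 1 F (f x).
Proof.
move=> ac c0 cf; have [F dF] := antiderivative_exists ac cf.
exists (fun x => F x - F 0); split; first by rewrite subrr.
move=> x cx; have h := dF x cx.
by apply: is_derive_eq; rewrite subr0.
Qed.

(* With [X = fOU theta B w] and [xi_t = e^{- theta t} X_t], integration by
   parts turns the numerator into [xi_T^2 / 2 + theta * \int_0^T xi^2]. The last
   hypothesis excludes that [\int_0^oo theta e^{- theta s} B_s ds], the limit of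
   [xi], vanishes. *)
Lemma theta_tilde2_cvg (R : realType) (d : measure_display) (T : measurableType d)
    (theta : R) (B : T -> R -> R) (w : T) :
  0 < theta -> B w 0 = 0 -> {within `[0, +oo[, continuous (B w)} ->
  (forall S : R, half_negligible_on 0 S (fun u _ v => B w v - B w u)) ->
  (exists C : R, forall t, 0 <= t -> `|B w t| <= C * (1 + t ^+ 2)) ->
  ~ (forall e : R, 0 < e -> exists n0 : nat, forall n, (n0 <= n)%N ->
      exists K0 : nat, forall K, (K0 <= K)%N ->
      `|\sum_(i < n * K.+1) K.+1%:R^-1 * (theta *
         (expR (- (theta * (i%:R * K.+1%:R^-1))) * B w (i%:R * K.+1%:R^-1)))| < e) ->
  theta_tilde2 theta B w Tm @[Tm --> +oo] --> theta.
Proof.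
move=> th0; set b := B w => b0 cb hb [C hC] hS.
have bc := continuous_comp_normr cb.
have cf (x : R) : {for x, continuous (fun x => expR (- theta * x) * b `|x|)}.
  by apply: cvgM; [exact: continuous_expRM|exact: bc].
(* The primitives are built on domains reaching to the left of 0, each shorter than the one before,
   so that their derivatives at 0 are two-sided. *)
have [Z [Z0 dZ']] : exists F : R -> R, F 0 = 0 /\
    forall x : R, -1 < x -> is_derive x 1 F (expR (- theta * x) * b `|x|).
  by apply: (@antiderivative_exists0 _ _ (-2)) => //; lra.
have dZ (x : R) : 0 <= x -> is_derive x 1 Z (expR (- theta * x) * b `|x|).
  by move=> x0; apply: dZ'; lra.
pose xi (t : R) : R := expR (- theta * t) * b `|t| + theta * Z t.
have cZ (x : R) : -1 < x -> {for x, continuous Z}.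
  move=> x0; apply: (derive_continuous_for (f := fun x => expR (- theta * x) * b `|x|)).
  exact: dZ'.
have cxi (x : R) : -1 < x -> {for x, continuous xi}.
  move=> x0; apply: cvgD; first exact: cf.
  by apply: cvgM; [exact: cvg_cst|exact: cZ].
have cxi2 (x : R) : -1 < x -> {for x, continuous (fun x => xi x ^+ 2)}.
  by move=> x0; apply: cvgM; exact: cxi.
have [A [A0 dA']] : exists F : R -> R, F 0 = 0 /\
    forall x : R, - 2^-1 < x -> is_derive x 1 F (xi x ^+ 2).
  by apply: (@antiderivative_exists0 _ _ (-1)) => //; lra.
have dA (x : R) : 0 <= x -> is_derive x 1 A (xi x ^+ 2).
  by move=> x0; apply: dA'; lra.
have XE s : 0 <= s -> fOU theta B w s = expR (theta * s) * xi s.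
  move=> s0; rewrite /fOU; congr (_ * _); apply: RSintE => //.
  exact: is_RS_exp_path.
have thE t : 0 <= t -> theta_tilde2 theta B w t = (xi t ^+ 2 / 2 + theta * A t) / A t.
  move=> t0; rewrite /theta_tilde2; congr (_ / _); apply: RSintE => //.
    exact: (is_RS_weighted_self (theta := theta) (b := b) (Z := Z)).
  exact: (is_RS_weighted_square (theta := theta) (b := b) (Z := Z)).
have M1 (t : R) : 0 <= t ->
    `|expR (- theta * t) * b `|t| | <= (C * (1 + 8 / theta ^+ 2)) * expR (- (theta / 2) * t).
  move=> t0; rewrite (ger0_norm t0) normrM ger0_norm ?expR_ge0//.
  have C0 : 0 <= C.
    by have := le_trans (normr_ge0 _) (hC 0 (lexx _)); rewrite expr0n/= addr0 mulr1.
  apply: (@le_trans _ _ (C * (expR (- theta * t) * (1 + t ^+ 2)))).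
    by rewrite mulrCA ler_wpM2l ?expR_ge0// hC.
  by rewrite -mulrA ler_wpM2l// expR_decay_poly2.
have th20 : 0 < theta / 2 by rewrite divr_gt0.
have [l cl] : exists l : R, Z t @[t --> +oo] --> l.
  exact: (cvg_antiderivative_decay th20 dZ M1).
have cb0 : expR (- theta * t) * b `|t| @[t --> +oo] --> 0.
  apply/norm_cvg0P; apply: (squeeze_cvgr (f := fun=> 0)
    (h := fun t => (C * (1 + 8 / theta ^+ 2)) * expR (- (theta / 2) * t))).
  - near=> t; rewrite normr_ge0/=; apply: M1.
    by near: t; apply: nbhs_pinfty_ge; exact: num_real.
  - exact: cvg_cst.
  - rewrite -[X in _ --> X](mulr0 (C * (1 + 8 / theta ^+ 2))).
    by apply: cvgM; [exact: cvg_cst|exact: cvg_expR_decay].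
have cxil : xi t @[t --> +oo] --> theta * l.
  rewrite -[X in _ --> X]add0r; apply: cvgD => //.
  by apply: cvgM => //; exact: cvg_cst.
(* The integral of [theta e^{- theta s} B_s] over [[0, n]] is [theta * Z n]. If [l = 0] it is small
   for large [n], and so are its fine Riemann sums, contrary to [hS]. *)
have l0 : l != 0.
  apply/eqP => l0; apply: hS => e e0.
  have cthZ : theta * Z t @[t --> +oo] --> 0.
    by rewrite -[X in _ --> X](mulr0 theta) -l0; apply: cvgM => //; exact: cvg_cst.
  have e20 : 0 < e / 2 by rewrite divr_gt0.
  have := cthZ; move=> /cvgr0Pnorm_lt /(_ _ e20)[M [_ hM]].
  exists (Num.bound M) => n Mn.
  have Mn' : M < n%:R.
    apply: lt_le_trans (_ : (Num.bound M)%:R <= _); last by rewrite ler_nat.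
    apply: le_lt_trans (ler_norm M) _; have := archi_boundP (normr_ge0 M).
    by rewrite /Num.bound normr_id.
  have n0 : 0 <= n%:R :> R by [].
  have hRS : is_RS (fun s => theta * (expR (- (theta * s)) * b s)) id 0 n%:R (theta * Z n%:R).
    have -> : theta * Z n%:R = theta * Z n%:R - theta * Z 0 by rewrite Z0 mulr0 subr0.
    apply: (@is_RS_negligible _ _ _ (fun x => theta * Z x)) => //.
    have pos (x : R) : 0 <= x <= n%:R -> 0 <= x by case/andP.
    have nZ := @negligible_derive R 0 n%:R Z _ (fun x h => dZ x (pos x h))
      (fun x _ => cf x).
    apply: negligible_ext_on (negligibleM (bounded_cst 0 n%:R (- theta)) nZ).
    move=> u t v u0 ut tv vn; rewrite (ger0_norm (le_trans u0 ut)).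
    by rewrite (_ : expR (- (theta * t)) = expR (- theta * t)) ?mulNr//=; ring.
  have [K0 hK0] := is_RS_riemann_sums hRS e20; exists K0 => K /hK0 h.
  have h2 := hM _ Mn'; move: h; set S := \sum_(_ < _) _ => h.
  have -> : S = (S - theta * Z n%:R) + theta * Z n%:R by ring.
  by apply: le_lt_trans (ler_normD _ _) _; rewrite [e]splitr ltrD.
have l1 : theta * l != 0 by rewrite mulf_neq0// gt_eqF.
apply: cvg_pinfty_near_eq (ratio_cvg cxil l1 dA).
near=> t; rewrite thE//; near: t; apply: nbhs_pinfty_ge; exact: num_real.
Unshelve. all: by end_near. Qed.

(** * Regularity and growth from dyadic increments *)

Lemma leq_ltS2_cases (x y : nat) : (x <= y -> y < x.+2 -> y = x \/ y = x.+1)%N.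
Proof. by lia. Qed.

Section DyadicChaining.
Context {R : realType} (b : R -> R) (r : R) (n0 : nat).
Hypothesis b_continuous : {within `[0, +oo[, continuous b}.
Hypothesis b0 : b 0 = 0.
Hypothesis r0 : 0 < r.
Hypothesis r1 : r < 1.
Hypothesis dyadic_increment : forall n k, (n0 <= n)%N -> (k < 4 ^ n)%N ->
  `|b (k.+1%:R / 2 ^+ n) - b (k%:R / 2 ^+ n)| <= r ^+ n.

Let fl (n : nat) (t : R) : nat := Num.truncn (t * 2 ^+ n).
Let dy (n : nat) (t : R) : R := (fl n t)%:R / 2 ^+ n.
(** The sum of [r ^+ j] over [j >= 1]: the total cost of refining from level 0. *)
Let c : R := r / (1 - r).

Let pow2_gt0 n : 0 < 2 ^+ n :> R. Proof. by rewrite exprn_gt0. Qed.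

Let fl_itv n t : 0 <= t -> (fl n t)%:R <= t * 2 ^+ n < (fl n t).+1%:R.
Proof. by move=> t0; apply: truncn_itv; rewrite mulr_ge0// ltW. Qed.

Let fl_lt m n t : 0 <= t -> t < 2 ^+ m -> (m <= n)%N -> (fl n t < 4 ^ n)%N.
Proof.
move=> t0 tm mn; rewrite -(ltr_nat R); have /andP[h _] := fl_itv n t0.
apply: le_lt_trans h _; rewrite natrX (_ : 4%:R = 2 * 2); last by rewrite -natrM.
by rewrite exprMn ltr_pM2r// (lt_le_trans tm)// ler_weXn2l// ler1n.
Qed.

(** Halving a cell keeps its left end or moves it by one step of the finer grid, so at most one
    increment of level [n + 1] is paid. *)
Let dyadic_step m n t : (n0 <= m)%N -> 0 <= t -> t < 2 ^+ m -> (m <= n)%N ->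
  `|b (dy n.+1 t) - b (dy n t)| <= r ^+ n.+1.
Proof.
move=> nm t0 tm mn; have /andP[h1 h2] := fl_itv n t0.
have dyE : dy n t = (fl n t).*2%:R / 2 ^+ n.+1.
  by rewrite /dy -muln2 natrM exprS; field; rewrite gt_eqF.
have := fl_itv n.+1 t0; rewrite exprS mulrCA => /andP[h3 h4].
have l1 : ((fl n t).*2 <= fl n.+1 t)%N.
  rewrite -ltnS -(ltr_nat R); apply: le_lt_trans h4.
  by rewrite -muln2 natrM mulrC ler_pM2l.
have l2 : (fl n.+1 t < (fl n t).+1.*2)%N.
  rewrite -(ltr_nat R); apply: le_lt_trans h3 _.
  by rewrite -muln2 natrM [ltRHS]mulrC ltr_pM2l.
rewrite doubleS in l2; have [E|E] := leq_ltS2_cases l1 l2.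
  by rewrite dyE /dy E subrr normr0 exprn_ge0// ltW.
rewrite dyE /dy E; apply: dyadic_increment; first exact: leqW (leq_trans nm mn).
by rewrite expnS; have := fl_lt t0 tm mn; move: (fl n t) (4 ^ n)%N => x y; clear; lia.
Qed.

Let dyadic_chain m n t : (n0 <= m)%N -> 0 <= t -> t < 2 ^+ m -> (m <= n)%N ->
  `|b (dy n t) - b (dy m t)| <= c * (r ^+ m - r ^+ n).
Proof.
move=> nm t0 tm; elim: n => [|n IH].
  by rewrite leqn0 => /eqP ->; rewrite !subrr normr0 mulr0.
rewrite leq_eqVlt => /orP[/eqP ->|]; first by rewrite !subrr normr0 mulr0.
rewrite ltnS => mn; have h1 := IH mn; have h2 := dyadic_step nm t0 tm mn.
have -> : b (dy n.+1 t) - b (dy m t) =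
  (b (dy n.+1 t) - b (dy n t)) + (b (dy n t) - b (dy m t)) by ring.
apply: le_trans (ler_normD _ _) _; apply: le_trans (lerD h2 h1) _.
rewrite le_eqVlt; apply/orP; left; apply/eqP; rewrite /c exprS; field.
by rewrite subr_eq0 gt_eqF.
Qed.

Let c_ge0 : 0 <= c. Proof. by apply: divr_ge0; rewrite ?subr_ge0 ltW. Qed.

Let dy_dist n t : 0 <= t -> `|t - dy n t| < 2^-1 ^+ n.
Proof.
move=> t0; have /andP[h1 h2] := fl_itv n t0.
have d1 : dy n t <= t by rewrite /dy ler_pdivrMr.
rewrite ger0_norm ?subr_ge0// ltrBlDr /dy exprVn -{1}[_^-1]mul1r -mulrDl.
by rewrite ltr_pdivlMr// addrC natr1.
Qed.

(** The chain bound is uniform in the final level, and continuity of the path lets the dyadic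
    approximations reach [t]. *)
Let dyadic_approx m t : (n0 <= m)%N -> 0 <= t -> t < 2 ^+ m ->
  `|b t - b (dy m t)| <= c * r ^+ m.
Proof.
move=> nm t0 tm; apply/ler_addgt0Pr => e e0.
have := @continuous_comp_normr _ _ b_continuous t => /cvgrPdist_lt /(_ _ e0)[d /= d0 hd].
have hlf : `|2^-1 : R| < 1 by rewrite ger0_norm// invf_lt1// ltr1n.
have := cvg_expr hlf => /cvgr0Pnorm_lt /(_ _ d0)[N _ hN].
pose n := maxn N m; have mn : (m <= n)%N by rewrite leq_maxr.
have dn0 : 0 <= dy n t by rewrite divr_ge0// ltW.
have h1 : `|b t - b (dy n t)| < e.
  have dn : `|t - dy n t| < d.
    apply: lt_trans (dy_dist _ t0) _.
    by have := hN n (leq_maxl _ _); rewrite /= ger0_norm// exprn_ge0.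
  by have := hd (dy n t) dn; rewrite (ger0_norm t0) (ger0_norm dn0).
have -> : b t - b (dy m t) = (b (dy n t) - b (dy m t)) + (b t - b (dy n t)) by ring.
apply: le_trans (ler_normD _ _) _; apply: lerD; last exact: ltW.
apply: le_trans (dyadic_chain nm t0 tm mn) _.
by rewrite ler_wpM2l// gerBl exprn_ge0// ltW.
Qed.

(** Points closer than [2^{-m}] lie in equal or adjacent cells of level [m]: two approximation
    errors and at most one increment. *)
Let dyadic_modulus m s t : (n0 <= m)%N -> 0 <= s -> s <= t -> t < 2 ^+ m ->
  t - s < 2^-1 ^+ m -> `|b t - b s| <= (2 * c + 1) * r ^+ m.
Proof.
move=> nm s0 st tm ts; have t0 := le_trans s0 st; have sm := le_lt_trans st tm.
have ht := dyadic_approx nm t0 tm; have hs := dyadic_approx nm s0 sm.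
have h : `|b (dy m t) - b (dy m s)| <= r ^+ m.
  have /andP[h1 h2] := fl_itv m t0; have /andP[h3 h4] := fl_itv m s0.
  have l1 : (fl m s <= fl m t)%N.
    rewrite -ltnS -(ltr_nat R); apply: le_lt_trans h2; apply: le_trans h3 _.
    by rewrite ler_wpM2r// ltW.
  have l2 : (fl m t < (fl m s).+2)%N.
    rewrite -(ltr_nat R); apply: le_lt_trans h1 _.
    have : t * 2 ^+ m < (s + 2^-1 ^+ m) * 2 ^+ m by rewrite ltr_pM2r// -ltrBlDl.
    rewrite mulrDl exprVn mulVf ?gt_eqF// => /lt_le_trans; apply.
    by rewrite -[leRHS]natr1 lerD2r ltW.
  have [E|E] := leq_ltS2_cases l1 l2.
    by rewrite /dy E subrr normr0 exprn_ge0// ltW.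
  by rewrite /dy E; apply: dyadic_increment => //; exact: (fl_lt s0 sm).
have -> : b t - b s = (b t - b (dy m t)) + ((b (dy m t) - b (dy m s)) - (b s - b (dy m s))) by ring.
apply: le_trans (ler_normD _ _) _.
have := ler_normB (b (dy m t) - b (dy m s)) (b s - b (dy m s)).
rewrite mulrDl mul1r; lra.
Qed.

(** At the least level [m >= n0] with [t < 2^m], a walk from 0 to the cell of [t] uses at most [4^m]
    increments, each at most 1. Minimality bounds [4^m] by [4^{n0} + 4 t^2]. *)
Lemma dyadic_growth : exists C : R, forall t, 0 <= t -> `|b t| <= C * (1 + t ^+ 2).
Proof.
exists (c + 4 ^+ n0 + 4) => t t0.
have ex : exists m, (n0 <= m)%N && (t < 2 ^+ m).
  exists (maxn n0 (Num.bound t)); rewrite leq_maxl/=.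
  apply: lt_le_trans (archi_boundP t0) _; rewrite -natrX ler_nat.
  apply: leq_trans (ltnW (ltn_expl _ (isT : 1 < 2)%N)) _.
  by rewrite leq_exp2l// leq_maxr.
case: (ex_minnP ex) => m /andP[nm tm] mmin.
have kb k : (k <= 4 ^ m)%N -> `|b (k%:R / 2 ^+ m)| <= k%:R.
  elim: k => [|k IH] km; first by rewrite mul0r b0 normr0.
  have h1 := IH (ltnW km); have h2 := dyadic_increment nm km.
  have rm : r ^+ m <= 1 by rewrite exprn_ile1// ltW.
  have -> : b (k.+1%:R / 2 ^+ m) =
    (b (k.+1%:R / 2 ^+ m) - b (k%:R / 2 ^+ m)) + b (k%:R / 2 ^+ m) by ring.
  apply: le_trans (ler_normD _ _) _; apply: le_trans (lerD h2 h1) _.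
  by rewrite -[leRHS]natr1 addrC lerD2l.
have h1 := dyadic_approx nm t0 tm; have h2 := kb _ (ltnW (fl_lt t0 tm (leqnn m))).
have h3 : (fl m t)%:R <= 4 ^+ m :> R.
  by rewrite -natrX ler_nat ltnW// (fl_lt t0 tm).
have h4 : (4 : R) ^+ m <= 4 ^+ n0 + 4 * t ^+ 2.
  move: mmin tm nm; case: m {kb h1 h2 h3} => [|m] mmin tm nm.
    by move: nm; rewrite leqn0 => /eqP ->; rewrite lerDl mulr_ge0// sqr_ge0.
  have [nm'|mn'] := leqP n0 m.
    have [tm'|tm'] := ltP t (2 ^+ m).
      by have := mmin m; rewrite nm' tm' ltnn => /(_ isT).
    apply: ler_wpDl; first exact: exprn_ge0.
    have E4 : 4 = 2 * 2 :> R by rewrite -natrM.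
    by rewrite exprS ler_pM2l// {1}E4 exprMn expr2 ler_pM// ltW.
  have -> : m.+1 = n0 by apply/eqP; rewrite eqn_leq mn' nm.
  by rewrite lerDl mulr_ge0// sqr_ge0.
have rm : c * r ^+ m <= c by rewrite ler_piMr// exprn_ile1// ltW.
have -> : b t = (b t - b (dy m t)) + b (dy m t) by ring.
apply: le_trans (ler_normD _ _) _; apply: le_trans (lerD h1 h2) _.
have t2 : 0 <= t ^+ 2 by exact: sqr_ge0.
have n40 : 0 <= 4 ^+ n0 :> R by exact: exprn_ge0.
have := mulr_ge0 c_ge0 t2; have := mulr_ge0 n40 t2; lra.
Qed.

(* The Holder exponent [- log2 r] exceeds 1/2. *)
Lemma dyadic_half_negligible (S : R) : 2 * r ^+ 2 < 1 ->
  half_negligible_on 0 S (fun u _ v => b v - b u).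
Proof.
(* The square comes from the modulus constant, the factor 2 from [v - u >= 2^{-(m+1)}]. *)
move=> r2 e e0; pose D := (2 * c + 1) ^+ 2 * 2.
have D0 : 0 < D.
  by rewrite mulr_gt0// exprn_gt0// ltr_wpDl// mulr_ge0.
have rr0 : 0 <= 2 * r ^+ 2 by rewrite mulr_ge0// sqr_ge0.
have nr : `|2 * r ^+ 2| < 1 by rewrite ger0_norm.
have eD : 0 < e / D by rewrite divr_gt0.
have := cvg_expr nr => /cvgr0Pnorm_lt /(_ _ eD)[N _ hN].
pose M := maxn N (maxn n0 (Num.bound S)).
have SM : S < 2 ^+ M.
  apply: le_lt_trans (ler_norm S) _; have := archi_boundP (normr_ge0 S).
  rewrite {1}/Num.bound normr_id -/(Num.bound S) => /lt_le_trans; apply.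
  rewrite -natrX ler_nat; apply: leq_trans (ltnW (ltn_expl _ (isT : 1 < 2)%N)) _.
  by rewrite leq_exp2l// /M !leq_max leqnn !orbT.
exists (2^-1 ^+ M); first by rewrite exprn_gt0.
move=> u t v u0 ut tv vS vu; have uv := le_trans ut tv.
rewrite ger0_norm ?sqr_ge0//.
have [->|/eqP uv'] := eqVneq u v; first by rewrite !subrr expr0n mulr0.
have x0 : 0 < v - u by rewrite subr_gt0 lt_neqAle uv andbT; apply/eqP.
have hlf : `|2^-1 : R| < 1 by rewrite ger0_norm// invf_lt1// ltr1n.
have ex : exists j, 2^-1 ^+ j <= v - u.
  have := cvg_expr hlf => /cvgr0Pnorm_lt /(_ _ x0)[j _ hj].
  by exists j; have := hj j (leqnn j); rewrite /= ger0_norm ?exprn_ge0// => /ltW.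
(* The least exponent is [m + 1], whence [2^{-(m+1)} <= v - u < 2^{-m}]; exponent 0 is excluded
   since [v - u < 2^{-M} <= 1]. *)
case: (ex_minnP ex) => -[|m] hm mmin.
  move: hm vu; rewrite expr0 => h1 h2; have := le_lt_trans h1 h2.
  by rewrite ltNge exprn_ile1// invf_le1// ler1n.
have vum : v - u < 2^-1 ^+ m.
  by rewrite ltNge; apply/negP => /mmin; rewrite ltnn.
have Mm : (M <= m)%N.
  rewrite leqNgt; apply/negP => mM; have := le_lt_trans hm vu; rewrite ltNge => /negP; apply.
  by rewrite ler_wiXn2l// invf_le1// ler1n.
have nm : (n0 <= m)%N by apply: leq_trans Mm; rewrite /M !leq_max leqnn orbT.
have vm : v < 2 ^+ m.
  by apply: le_lt_trans vS _; apply: lt_le_trans SM _; rewrite ler_weXn2l// ler1n.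
have h := dyadic_modulus nm u0 uv vm vum.
have hNm : (2 * r ^+ 2) ^+ m < e / D.
  have Nm : (N <= m)%N by apply: leq_trans Mm; rewrite leq_maxl.
  by have := hN m Nm; rewrite /= ger0_norm// exprn_ge0.
have : (b v - b u) ^+ 2 <= ((2 * c + 1) * r ^+ m) ^+ 2.
  by rewrite -(real_normK (num_real (b v - b u))) lerXn2r ?nnegrE// (le_trans _ h).
move=> /le_trans; apply.
have -> : ((2 * c + 1) * r ^+ m) ^+ 2 = D * ((2 * r ^+ 2) ^+ m * 2^-1 ^+ m.+1).
  have n2 : 2 ^+ m != 0 :> R by rewrite gt_eqF.
  rewrite (exprMn 2 (2 * c + 1) (r ^+ m)) (exprAC r) (exprMn m 2 (r ^+ 2)) (exprS 2^-1 m) exprVn /D.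
  by move: n2 (2 * c + 1) (r ^+ 2 ^+ m) => + x y; move: (2 ^+ m) => z n2; field.
have -> : e = D * (e / D) by field; rewrite gt_eqF.
rewrite -mulrA ler_wpM2l ?(ltW D0)// ler_pM ?exprn_ge0//; exact: ltW.
Qed.

End DyadicChaining.

(** * Fractional Brownian motion *)

Lemma powR_exprn {R : realType} (x p : R) n : 0 <= x -> (x ^+ n) `^ p = (x `^ p) ^+ n.
Proof. by move=> x0; rewrite -!powR_mulrn ?powR_ge0// powRAC. Qed.

(* [expR x >= x^j / j!], with [j] such that [beta^j >= 8] *)
Lemma expR_pow_decay {R : realType} (beta : R) : 1 < beta ->
  exists K : R, forall n, 4 ^+ n * expR (- (beta ^+ n / 2)) <= K / 2 ^+ n.
Proof.
move=> b1; have b0 : 0 < beta by exact: lt_trans b1.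
have [j hj] : exists j, 8 <= beta ^+ j.+1.
  have hV : `|beta^-1| < 1 by rewrite ger0_norm ?invr_ge0 ?(ltW b0)// invf_lt1.
  have h8 : 0 < 8^-1 :> R by rewrite invr_gt0.
  have := cvg_expr hV => /cvgr0Pnorm_lt /(_ _ h8)[N _ hN]; exists N.
  have := hN N.+1 (leqnSn N); rewrite /= ger0_norm ?exprn_ge0 ?invr_ge0 ?(ltW b0)//.
  by rewrite exprVn ltf_pV2 ?posrE ?exprn_gt0// => /ltW.
exists (j.+1`!%:R * 2 ^+ j.+1) => n; set x := beta ^+ n / 2.
have x0 : 0 < x by rewrite divr_gt0// exprn_gt0.
have f0 : 0 < j.+1`!%:R :> R by rewrite ltr0n fact_gt0.
have h : x ^+ j.+1 / j.+1`!%:R <= expR x.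
  by apply: le_trans (expR_ge1Dxn j (ltW x0)); rewrite lerDr.
(* Against the factor [4 ^+ n], the growth [8 ^+ n] leaves the required [2^{-n}]. *)
have xj : 8 ^+ n / 2 ^+ j.+1 <= x ^+ j.+1.
  rewrite /x expr_div_n ler_pM2r ?invr_gt0 ?exprn_gt0// exprAC.
  by rewrite lerXn2r// nnegrE ?exprn_ge0// ltW.
rewrite expRN ler_pdivrMr ?expR_gt0//.
have E8 : 8 ^+ n = 4 ^+ n * 2 ^+ n :> R by rewrite -exprMn -natrM.
apply: (@le_trans _ _ (j.+1`!%:R * 2 ^+ j.+1 / 2 ^+ n * (x ^+ j.+1 / j.+1`!%:R))).
  have -> : 4 ^+ n = j.+1`!%:R * 2 ^+ j.+1 / 2 ^+ n * ((8 ^+ n / 2 ^+ j.+1) / j.+1`!%:R) :> R.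
    have yn : 2 ^+ n != 0 :> R by rewrite expf_neq0.
    have zn : 2 ^+ j.+1 != 0 :> R by rewrite expf_neq0.
    have fn := lt0r_neq0 f0; rewrite E8; move: yn zn fn.
    move: (2 ^+ n) (2 ^+ j.+1) (4 ^+ n) (j.+1`!%:R) => y z u f yn zn fn; field.
    by rewrite ?fn ?yn ?zn.
  rewrite ler_wpM2l ?mulr_ge0 ?invr_ge0 ?exprn_ge0 ?(ltW f0)//.
  by rewrite ler_pM2r// invr_gt0.
by rewrite ler_wpM2l// ?mulr_ge0 ?invr_ge0 ?exprn_ge0 ?(ltW f0).
Qed.

Section FractionalBrownianMotion.
Context {R : realType} {d : measure_display} {T : measurableType d}.
Variables (P : probability T R) (H : R) (B : T -> R -> R).
Hypothesis H_gt : 1 / 2 < H.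
Hypothesis B_fbm : is_fBm P H B.

Let H2_gt0 : 0 < 2 * H. Proof. by have := H_gt; lra. Qed.

Lemma fbm_cov_diag (t : R) : fbm_cov H t t = t `^ (2 * H).
Proof. by rewrite /fbm_cov subrr normr0 powR0 ?gt_eqF// subr0; field. Qed.

Lemma fbm_cov_sym (s t : R) : fbm_cov H t s = fbm_cov H s t.
Proof. by rewrite /fbm_cov distrC [s `^ _ + _]addrC. Qed.

(** For [s <= t], monotonicity of the power gives [(t - s)^{2H} <= t^{2H}]. *)
Lemma fbm_cov_ge0 (s t : R) : 0 <= s -> 0 <= t -> 0 <= fbm_cov H t s.
Proof.
wlog st : s t / s <= t => [h s0 t0|s0 t0].
  have [st|/ltW ts] := leP s t; first exact: h.
  by rewrite fbm_cov_sym; exact: h.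
rewrite divr_ge0// subr_ge0 ger0_norm ?subr_ge0//.
apply: (@le_trans _ _ (t `^ (2 * H))); last by rewrite lerDl powR_ge0.
by rewrite ge0_ler_powR ?nnegrE ?subr_ge0 ?(ltW H2_gt0)// gerBl.
Qed.

Lemma fbm_cov_ge_half (s t : R) : 1 <= s -> s <= 2 -> 1 <= t -> t <= 2 ->
  2^-1 <= fbm_cov H t s.
Proof.
move=> s1 s2 t1 t2; rewrite /fbm_cov -[leLHS]mul1r ler_pM2r ?invr_gt0//.
have p1 : 1 `^ (2 * H) = 1 :> R by rewrite powR1.
have hp u : 1 <= u -> 1 <= u `^ (2 * H).
  move=> u1; have u0 : 0 <= u by exact: le_trans u1.
  by rewrite -[leLHS]p1 ge0_ler_powR ?nnegrE ?(ltW H2_gt0).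
have : `|t - s| `^ (2 * H) <= 1.
  rewrite -[leRHS]p1 ge0_ler_powR ?nnegrE ?(ltW H2_gt0)//.
  by rewrite ler_norml; apply/andP; split; lra.
by have := hp s s1; have := hp t t1; lra.
Qed.

Lemma fbm_increment_gaussian (s t : R) : 0 <= s -> 0 <= t ->
  centered_gaussian P (fun w => B w t - B w s) (`|t - s| `^ (2 * H)).
Proof.
move=> s0 t0; pose f (x y : R) (i : 'I_2) := if i == ord0 then x else y.
have [_ [_ h]] := B_fbm; have ft i : 0 <= f s t i by rewrite /f; case: ifP.
have {h} := h 2 (f s t) (f (-1) 1) ft.
have -> : (fun w => \sum_(i < 2) f (-1) 1 i * B w (f s t i)) =
    (fun w => B w t - B w s).
  by apply/funext => w; rewrite !big_ord_recl !big_ord0 /f/=; ring.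
suff -> : \sum_(i < 2) \sum_(j < 2) f (-1) 1 i * f (-1) 1 j *
    fbm_cov H (f s t i) (f s t j) = `|t - s| `^ (2 * H) by [].
rewrite !big_ord_recl !big_ord0 /f/= !fbm_cov_diag (fbm_cov_sym t s) /fbm_cov.
by field.
Qed.

(** [q ^+ n] is the variance of an increment over a step [2^{-n}]. Since [H > 1/2] gives [q < 1/2],
    there is room for [rho] strictly between. *)
Let q : R := 2^-1 `^ (2 * H).
Let rho : R := (q + 2^-1) / 2.

Let q_gt0 : 0 < q. Proof. by rewrite powR_gt0// invr_gt0. Qed.

Let q_lt : q < 2^-1.
Proof.
have h2 : 0 < 2^-1 :> R by rewrite invr_gt0.
have p0 : 0 < 2 * H - 1 by have := H_gt; lra.
have -> : q = 2^-1 * 2^-1 `^ (2 * H - 1).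
  rewrite -[X in X * _](powRr1 (ltW h2)) -powRD.
    by rewrite /q; congr (_ `^ _); ring.
  by apply/implyP => _; rewrite gt_eqF.
have p1 : 1 `^ (2 * H - 1) = 1 :> R by rewrite powR1.
rewrite gtr_pMr// -[ltRHS]p1.
by rewrite gt0_ltr_powR ?nnegrE ?(ltW h2)// invf_lt1// ltr1n.
Qed.

(** Borel-Cantelli with thresholds [r ^+ n], where [r ^+ 2 = rho]. The tail exponent
    [(rho / q)^n / 2] grows geometrically because [rho > q], which beats the [4^n] cells;
    [rho < 1/2] gives [2 * r ^+ 2 < 1]. *)
Lemma fbm_dyadic_increments : exists r : R, [/\ 0 < r, r < 1, 2 * r ^+ 2 < 1 &
  {ae P, forall w, exists n0 : nat, forall n k : nat, (n0 <= n)%N -> (k < 4 ^ n)%N ->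
    `|B w (k.+1%:R / 2 ^+ n) - B w (k%:R / 2 ^+ n)| <= r ^+ n}].
Proof.
have rho0 : 0 < rho by rewrite /rho; have := q_gt0; lra.
pose r := Num.sqrt rho; have r2 : r ^+ 2 = rho by rewrite sqr_sqrtr// ltW.
have r0 : 0 < r by rewrite sqrtr_gt0.
have rr : 2 * r ^+ 2 < 1 by rewrite r2 /rho; have := q_lt; lra.
exists r; split => //.
  by rewrite -sqrtr1 ltr_sqrt// /rho; have := q_lt; lra.
pose Y n k w := B w (k.+1%:R / 2 ^+ n) - B w (k%:R / 2 ^+ n).
have GY n k : centered_gaussian P (Y n k) (q ^+ n).
  have h x : 0 <= x%:R / 2 ^+ n :> R by rewrite divr_ge0// exprn_ge0.
  have := fbm_increment_gaussian (h k) (h k.+1).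
  suff -> : `|k.+1%:R / 2 ^+ n - k%:R / 2 ^+ n| `^ (2 * H) = q ^+ n by [].
  rewrite -mulrBl -natr1 addrAC subrr add0r mul1r ger0_norm ?invr_ge0 ?exprn_ge0//.
  by rewrite -exprVn powR_exprn// invr_ge0.
pose E n k : set T := [set w | r ^+ n < `|Y n k w|].
have mE n k : measurable (E n k).
  have [mY _] := GY n k; rewrite -[E n k]setTI.
  have mn : measurable_fun setT (fun w => `|Y n k w|) by exact: measurableT_comp.
  have -> : [set: T] `&` E n k = [set: T] `&` (fun w => `|Y n k w|) @^-1` `]r ^+ n, +oo[%classic.
    by apply/seteqP; split=> w /=; rewrite in_itv/= andbT.
  exact: mn.
have beta1 : 1 < rho / q by rewrite ltr_pdivlMr// mul1r /rho; have := q_lt; lra.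
have [K hK] := expR_pow_decay beta1.
have PE n k : (P (E n k) <= (expR (- ((rho / q) ^+ n / 2)) *+ 2)%:E)%E.
  have qn : 0 < q ^+ n by rewrite exprn_gt0.
  have rn : 0 <= r ^+ n by rewrite exprn_ge0// ltW.
  have := centered_gaussian_tail qn rn (GY n k).
  suff -> : r ^+ n ^+ 2 / (q ^+ n *+ 2) = (rho / q) ^+ n / 2 by [].
  rewrite exprAC r2 (expr_div_n rho q n); have qn0 := lt0r_neq0 qn.
  by move: qn0; move: (rho ^+ n) (q ^+ n) => x y y0; field.
pose F n : set T := \big[setU/set0]_(k < 4 ^ n) E n k.
have mF n : measurable (F n) by apply: bigsetU_measurable.
(* The union bound gives [2 K / 2^n], written in the shape of the geometric series summed below. *)
have PF n : (P (F n) <= (4 * K / (2 ^ (n + 1))%:R)%:E)%E.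
  apply: le_trans (Boole_inequality P _) _; first by move=> i _; exact: mE.
  apply: (@le_trans _ _ (\sum_(k < 4 ^ n) (expR (- ((rho / q) ^+ n / 2)) *+ 2)%:E)%E).
    by apply: lee_sum => k _; exact: PE.
  rewrite sumEFin lee_fin sumr_const card_ord -[leLHS]mulr_natr natrX.
  rewrite -[X in X * _]mulr_natr natrX addn1 exprS invfM.
  by have := hK n; lra.
have null : P (lim_sup_set F) = 0.
  apply: lim_sup_set_cvg0 => //.
  apply: (@le_lt_trans _ _ (\sum_(0 <= n <oo) (4 * K / (2 ^ (n + 1))%:R)%:E)%E).
    by apply: lee_nneseries => [n _ _|n _]; [exact: measure_ge0|exact: PF].
  by have /cvg_lim -> := @cvg_geometric_eseries_half R (4 * K) 0; rewrite ?ltry.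
exists (lim_sup_set F); split=> //.
  by apply: bigcap_measurableType => n _; exact: bigcup_measurable.
move=> w /= nw n _; apply: contrapT => hn; apply: nw; exists n => m k nm km.
rewrite leNgt; apply/negP => h; apply: hn; exists m => //=.
by rewrite /F -bigcup_mkord; exists k.
Qed.

End FractionalBrownianMotion.

(* Weights and covariances are nonnegative, so only the sample points in
   [[1, 2]] are kept; their weights add up to at least [theta * e^{- 2 theta}]. *)
Lemma fbm_riemann_sum_variance (R : realType) (H theta : R) (n K : nat) :
  1 / 2 < H -> 0 < theta -> (2 <= n)%N ->
  2^-1 * (theta * expR (- (theta * 2))) ^+ 2 <=
  \sum_(i < n * K.+1) \sum_(j < n * K.+1)
    (K.+1%:R^-1 * (theta * expR (- (theta * (i%:R * K.+1%:R^-1))))) *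
    (K.+1%:R^-1 * (theta * expR (- (theta * (j%:R * K.+1%:R^-1))))) *
    fbm_cov H (i%:R * K.+1%:R^-1) (j%:R * K.+1%:R^-1).
Proof.
move=> H_gt th0 n2; set N := (n * K.+1)%N; set h : R := K.+1%:R^-1.
have h0 : 0 < h by rewrite invr_gt0.
pose t (i : nat) : R := i%:R * h; have t0 i : 0 <= t i by rewrite mulr_ge0// ltW.
pose c (i : nat) : R := h * (theta * expR (- (theta * t i))).
have c0 i : 0 <= c i by rewrite !mulr_ge0 ?expR_ge0// ltW.
pose a (i : nat) : R := if (K.+1 <= i < 2 * K.+1)%N then c i else 0.
have a0 i : 0 <= a i by rewrite /a; case: ifP.
have tI i : (K.+1 <= i < 2 * K.+1)%N -> 1 <= t i <= 2.
  move=> /andP[i1 i2]; rewrite /t /h ler_pdivlMr// ler_pdivrMr// mul1r ler_nat i1/=.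
  by rewrite -natrM ler_nat ltnW.
have low i j : a i * a j * 2^-1 <= c i * c j * fbm_cov H (t i) (t j).
  have rhs0 : 0 <= c i * c j * fbm_cov H (t i) (t j).
    by apply: mulr_ge0; [exact: mulr_ge0|exact: fbm_cov_ge0].
  rewrite {1}/a; case: ifPn => [iI|_]; last by rewrite !mul0r.
  rewrite /a; case: ifPn => [jI|_]; last by rewrite mulr0 mul0r.
  have /andP[i1 i2] := tI i iI; have /andP[j1 j2] := tI j jI.
  by apply: ler_wpM2l; [exact: mulr_ge0|exact: fbm_cov_ge_half].
have sa : theta * expR (- (theta * 2)) <= \sum_(i < N) a i.
  rewrite -(big_mkord xpredT a) (@big_cat_nat _ _ _ K.+1)//=; last first.
    by rewrite leq_pmull// (leq_trans _ n2).
  rewrite [X in _ + X](@big_cat_nat _ _ _ (2 * K.+1))//=; last 2 first.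
  - by rewrite leq_pmull.
  - by rewrite leq_mul2r n2 orbT.
  apply: (@le_trans _ _ (\sum_(K.+1 <= i < 2 * K.+1) a i)); last first.
    by rewrite addrCA lerDl addr_ge0 ?sumr_ge0.
  (* There are [K + 1] sample points in the window, each weighted by [h = 1 / (K + 1)], and the
     exponential is least at time 2. *)
  apply: (@le_trans _ _ (\sum_(K.+1 <= i < 2 * K.+1) h * (theta * expR (- (theta * 2))))).
    rewrite sumr_const_nat (_ : (2 * K.+1 - K.+1 = K.+1)%N); last first.
      by rewrite mul2n -addnn addnK.
    by rewrite -[leRHS]mulr_natl mulrA /h divff ?mul1r// pnatr_eq0.
  apply: ler_sum_nat => i iI; rewrite /a iI /c.
  rewrite ler_pM2l// ler_pM2l// ler_expR lerN2 ler_pM2l//.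
  by have /andP[_ ->] := tI i iI.
apply: (@le_trans _ _ (\sum_(i < N) \sum_(j < N) a i * a j * 2^-1)); last first.
  by apply: ler_sum => i _; apply: ler_sum => j _; exact: low.
have -> : \sum_(i < N) \sum_(j < N) a i * a j * 2^-1 = 2^-1 * (\sum_(i < N) a i) ^+ 2.
  rewrite expr2 mulr_suml mulr_sumr; apply: eq_bigr => i _.
  by rewrite -mulr_suml -mulr_sumr mulrC.
rewrite ler_pM2l ?invr_gt0// lerXn2r// nnegrE ?sumr_ge0//.
by rewrite mulr_ge0 ?expR_ge0// ltW.
Qed.

(** The small-ball bound is linear in [e], uniformly in [K] and [n >= 2]. It survives both lower
    limits of events, and letting [e] tend to 0 leaves a null set. *)
Lemma fbm_riemann_sums_not_small (R : realType) (d : measure_display)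
  (T : measurableType d) (P : probability T R) (H theta : R) (B : T -> R -> R) :
  1 / 2 < H -> 0 < theta -> is_fBm P H B ->
  {ae P, forall w,
    ~ (forall e : R, 0 < e -> exists n0 : nat, forall n, (n0 <= n)%N ->
      exists K0 : nat, forall K, (K0 <= K)%N ->
      `|\sum_(i < n * K.+1) K.+1%:R^-1 * (theta *
         (expR (- (theta * (i%:R * K.+1%:R^-1))) * B w (i%:R * K.+1%:R^-1)))| < e)}.
Proof.
move=> H_gt th0 [_ [_ fB]].
pose S n K w := \sum_(i < n * K.+1) K.+1%:R^-1 * (theta *
  (expR (- (theta * (i%:R * K.+1%:R^-1))) * B w (i%:R * K.+1%:R^-1))).
pose c0 := 2^-1 * (theta * expR (- (theta * 2))) ^+ 2.
have c00 : 0 < c0 by rewrite mulr_gt0 ?invr_gt0// exprn_gt0// mulr_gt0// expR_gt0.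
have GS n K : exists v, centered_gaussian P (S n K) v /\ ((2 <= n)%N -> c0 <= v).
  pose t (i : 'I_(n * K.+1)) : R := i%:R * K.+1%:R^-1.
  pose c (i : 'I_(n * K.+1)) : R := K.+1%:R^-1 * (theta * expR (- (theta * t i))).
  exists (\sum_i \sum_j c i * c j * fbm_cov H (t i) (t j)); split; last first.
    by move=> n2; exact: fbm_riemann_sum_variance.
  have -> : S n K = (fun w => \sum_i c i * B w (t i)).
    by apply/funext => w; apply: eq_bigr => i _; rewrite /c /t !mulrA.
  by apply: fB => i; rewrite mulr_ge0// invr_ge0.
pose F e n K : set T := [set w | `|S n K w| < e].
have mF e n K : measurable (F e n K).
  have [v [[mS _] _]] := GS n K; rewrite -[F e n K]setTI.
  have mn : measurable_fun setT (fun w => `|S n K w|) by exact: measurableT_comp.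
  have -> : [set: T] `&` F e n K = [set: T] `&` (fun w => `|S n K w|) @^-1` `]-oo, e[%classic.
    by apply/seteqP; split=> w /=; rewrite in_itv/=.
  exact: mn.
(* The nested lower limits, first in [K] and then in [n], mirror the quantifiers of the
   statement. *)
pose G e n : set T := lim_inf_set (F e n).
have mG e n : measurable (G e n) by apply: measurable_lim_inf_set.
pose N e : set T := lim_inf_set (G e).
have mN e : measurable (N e) by apply: measurable_lim_inf_set.
pose M := normal_peak (Num.sqrt c0).
have PN e : 0 <= e -> (P (N e) <= (M * (e *+ 2))%:E)%E.
  move=> e0; apply: (@lim_inf_set_le _ _ _ P _ _ 2) => // n n2.
  apply: (@lim_inf_set_le _ _ _ P _ _ 0) => // K _.
  have [v [Gv cv]] := GS n K.
  exact: centered_gaussian_ball c00 (cv n2) e0 Gv.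
(* Restricting [e] to the values [1 / (k + 1)] keeps the exceptional set measurable. *)
pose N0 : set T := \bigcap_k N k.+1%:R^-1.
exists N0; split.
- by apply: bigcap_measurableType.
- apply/eqP; rewrite -measure_le0; apply/lee_addgt0Pr => e e0; rewrite add0e.
  have M0 : 0 <= M by exact: normal_peak_ge0.
  have M1 : 0 < M + 1 by rewrite ltr_wpDl.
  pose k := Num.bound ((M + 1) * 2 / e).
  have k0 : 0 < k.+1%:R^-1 :> R by rewrite invr_gt0.
  apply: (@le_trans _ _ (P (N k.+1%:R^-1))).
    apply: le_measure; rewrite ?inE//; first exact: bigcap_measurableType.
    exact: bigcap_inf.
  apply: le_trans (PN _ (ltW k0)) _; rewrite lee_fin.
  have hk : (M + 1) * 2 / e < k.+1%:R.
    apply: lt_le_trans (archi_boundP _) _.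
      by rewrite divr_ge0 ?(ltW e0)// mulr_ge0// ltW.
    by rewrite ler_nat.
  rewrite (_ : M * (k.+1%:R^-1 *+ 2) = M * 2 / k.+1%:R); last by ring.
  rewrite ler_pdivrMr// mulrC [leRHS]mulrC.
  by move: hk; rewrite ltr_pdivrMr//; lra.
- move=> w /= /contrapT hw k _; have k0 : 0 < k.+1%:R^-1 :> R by rewrite invr_gt0.
  have [n0 hn0] := hw _ k0; exists n0 => // n /= nn; have [K0 hK0] := hn0 n nn.
  by exists K0 => // K /= KK; exact: hK0.
Qed.

Theorem theorem4p8 (R : realType) (d : measure_display) (T : measurableType d)
  (P : probability T R) (H theta : R) (B : T -> R -> R) :
  1 / 2 < H -> H < 1 -> 0 < theta ->
  is_fBm P H B ->
  {ae P, forall w, theta_tilde2 theta B w Tm @[Tm --> +oo] --> theta}.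
Proof.
move=> H_gt H_lt th0 fB; have [B0 [cB _]] := fB.
have [r [r0 r1 r2 dy]] := fbm_dyadic_increments H_gt fB.
(* On the intersection of the four almost sure events the argument is deterministic. *)
have ns := fbm_riemann_sums_not_small H_gt th0 fB.
apply: filterS2 (filterI B0 cB) (filterI dy ns) => w [b0 cb] [[n0 hn0] nsw].
apply: theta_tilde2_cvg => //.
- by move=> S; exact: dyadic_half_negligible hn0 _ _.
- exact: dyadic_growth hn0.
Qed.
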